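(* Let $\Sigma$ be a $C^2$ complete, connected, oriented, constant mean curvature surface in $(\mathbb{S}^3,g_h)$. If $\Sigma$ is vertical then $\Sigma$ is congruent with a Clifford torus $\mathcal{T}_\rho$ for some $\rho\in(0,1)$.
   Context: Identify $(x_1,y_1,x_2,y_2)\in\mathbb{R}^4$ with the quaternion $x_1+iy_1+jx_2+ky_2$ and with the pair $(z_1,z_2)$, $z_n=x_n+iy_n$; $p\cdot q$ is the quaternion product and $\langle\cdot,\cdot\rangle$ the Euclidean product. $\mathbb{S}^3$ is the unit sphere with the induced Riemannian metric $g$. Put $V(p)=i\cdot p$, $E_1(p)=j\cdot p$, $E_2(p)=k\cdot p$. The horizontal distribution $\mathcal{H}$ is spanned by $E_1,E_2$, and $g_h$ is the restriction of $g$ to $\mathcal{H}$. A $C^1$ surface is vertical if the vector field $V$ is tangent to it. For a $C^2$ (immersed) surface $\Sigma$ with unit normal $N$ in $(\mathbb{S}^3,g)$, put $N_h=N-\langle N,V\rangle V$, and let $\Sigma_0=\{N_h=0\}$ be the singular set. On $\Sigma-\Sigma_0$ put $\nu_h=N_h/|N_h|$; the mean curvature $H$ in $(\mathbb{S}^3,g_h)$ is defined by $-2H=\mathrm{div}_\Sigma\nu_h$, the divergence relative to $\Sigma$. Constant mean curvature means $H$ is constant on $\Sigma-\Sigma_0$. Complete means complete in $(\mathbb{S}^3,g)$. Two surfaces are congruent if some isometry of $(\mathbb{S}^3,g)$ preserving $\mathcal{H}$ maps one onto the other. For $\rho\in(0,1)$ the Clifford torus is $\mathcal{T}_\rho=\{(z_1,z_2)\in\mathbb{S}^3:|z_1|^2=\rho^2\}$.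 *)

(* Defs.v *)
From HB Require Import structures.
From mathcomp Require Import all_boot all_order all_algebra.
From mathcomp Require Import all_classical all_reals all_analysis.

Set Implicit Arguments.
Unset Strict Implicit.
Unset Printing Implicit Defensive.

Import Order.TTheory GRing.Theory Num.Theory.
Import numFieldNormedType.Exports.

Local Open Scope classical_set_scope.
Local Open Scope ring_scope.

(* The library norm on 'rV[R]_n is the sup norm, so the Euclidean structure
   is introduced separately; the two norms define the same topology and the
   same differentials. *)
Definition dot (R : realType) (n : nat) (u v : 'rV[R]_n) : R :=
  \sum_(i < n) u 0 i * v 0 i.

Definition enorm (R : realType) (n : nat) (u : 'rV[R]_n) : R :=
  Num.sqrt (dot u u).

(* Quaternions: [quat x1 y1 x2 y2] is x1 + i y1 + j x2 + k y2, that is, the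
   pair (z1, z2) with z1 = x1 + i y1 and z2 = x2 + i y2. *)
Definition quat (R : realType) (a b c d : R) : 'rV[R]_4 :=
  \row_(i < 4) [:: a; b; c; d]`_i.

Definition qmul (R : realType) (p q : 'rV[R]_4) : 'rV[R]_4 :=
  quat (p 0 0 * q 0 0 - p 0 1 * q 0 1 - p 0 2 * q 0 2 - p 0 3 * q 0 3)
       (p 0 0 * q 0 1 + p 0 1 * q 0 0 + p 0 2 * q 0 3 - p 0 3 * q 0 2)
       (p 0 0 * q 0 2 - p 0 1 * q 0 3 + p 0 2 * q 0 0 + p 0 3 * q 0 1)
       (p 0 0 * q 0 3 + p 0 1 * q 0 2 - p 0 2 * q 0 1 + p 0 3 * q 0 0).

Definition vfV (R : realType) (p : 'rV[R]_4) : 'rV[R]_4 :=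
  qmul (quat 0 1 0 0) p.
Definition vfE1 (R : realType) (p : 'rV[R]_4) : 'rV[R]_4 :=
  qmul (quat 0 0 1 0) p.
Definition vfE2 (R : realType) (p : 'rV[R]_4) : 'rV[R]_4 :=
  qmul (quat 0 0 0 1) p.

Definition S3 (R : realType) : set 'rV[R]_4 := [set p | enorm p = 1].

Definition tangentS3 (R : realType) (p : 'rV[R]_4) : set 'rV[R]_4 :=
  [set v | dot v p = 0].

Definition horizontal (R : realType) (p : 'rV[R]_4) : set 'rV[R]_4 :=
  [set v | exists a b : R, v = a *: vfE1 p + b *: vfE2 p].

Fixpoint Ck (R : realType) (n m k : nat) (U : set 'rV[R]_n.+1)
    (F : 'rV[R]_n.+1 -> 'rV[R]_m.+1) {struct k} : Prop :=
  if k is k'.+1 then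
    (forall u, U u -> differentiable F u) /\
    (forall v, Ck k' U (fun u => 'D_v F u))
  else forall u, U u -> {for u, continuous F}.

(* Immersed surfaces of S^3 are maps f : M -> R^4 with values in S^3.  The
   local parametrizations are the homeomorphisms X from an open set U of R^2
   onto an open set of M such that f \o X is a C^2 immersion; they are
   automatically C^2-compatible with one another, hence f determines the C^2
   structure of M for which it is a C^2 immersion. *)
Record local_param (R : realType) (M : topologicalType) (f : M -> 'rV[R]_4)
    (U : set 'rV[R]_2) (X : 'rV[R]_2 -> M) : Prop := LocalParam {
  lp_open : open U ;
  lp_continuous : forall u, U u -> {for u, continuous X} ;
  lp_injective : forall u v, U u -> U v -> X u = X v -> u = v ;
  lp_open_map : forall O : set 'rV[R]_2, open O -> O `<=` U -> open (X @` O) ;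
  lp_C2 : Ck 2 U (f \o X) ;
  lp_immersion : forall u, U u -> injective ('d (f \o X) u)
}.

Record C2_surface (R : realType) (M : topologicalType) (f : M -> 'rV[R]_4)
    : Prop := C2Surface {
  surf_nonempty : [set: M] !=set0 ;
  surf_hausdorff : hausdorff_space M ;
  surf_countable : @second_countable M ;
  surf_S3 : forall m, S3 (f m) ;
  surf_param : forall m, exists U X u, [/\ local_param f U X, U u & X u = m]
}.

Definition tangent (R : realType) (M : topologicalType) (f : M -> 'rV[R]_4)
    (m : M) : set 'rV[R]_4 :=
  [set v | exists U X u a,
     [/\ local_param f U X, U u, X u = m & v = 'd (f \o X) u a]].

Definition vertical (R : realType) (M : topologicalType) (f : M -> 'rV[R]_4)
    : Prop :=
  forall m, tangent f m (vfV (f m)).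

(* As S^3 is oriented, an orientation of the surface is the same as a
   continuous choice of unit normal in S^3. *)
Record unit_normal (R : realType) (M : topologicalType) (f N : M -> 'rV[R]_4)
    : Prop := UnitNormal {
  normal_continuous : continuous N ;
  normal_unit : forall m, enorm (N m) = 1 ;
  normal_S3 : forall m, tangentS3 (f m) (N m) ;
  normal_orth : forall m v, tangent f m v -> dot (N m) v = 0
}.

Definition hnormal (R : realType) (M : topologicalType) (f N : M -> 'rV[R]_4)
    (m : M) : 'rV[R]_4 :=
  N m - dot (N m) (vfV (f m)) *: vfV (f m).

Definition singular (R : realType) (M : topologicalType) (f N : M -> 'rV[R]_4)
    : set M :=
  [set m | hnormal f N m = 0].

Definition nuh (R : realType) (M : topologicalType) (f N : M -> 'rV[R]_4)
    (m : M) : 'rV[R]_4 :=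
  (enorm (hnormal f N m))^-1 *: hnormal f N m.

(* Levi-Civita covariant derivative in S^3 of a vector field W along the
   surface, in the tangent direction of coordinates [a] at the point X u: the
   tangential part of the derivative in R^4. *)
Definition covder (R : realType) (M : topologicalType) (f W : M -> 'rV[R]_4)
    (X : 'rV[R]_2 -> M) (u a : 'rV[R]_2) : 'rV[R]_4 :=
  let w := 'd (W \o X) u a in w - dot w (f (X u)) *: f (X u).

(* [c] is the sum of <D_{e_i} W, e_i> over any orthonormal basis (e_1, e_2)
   of the tangent plane at m, read in any local parametrization. *)
Definition is_divergence (R : realType) (M : topologicalType)
    (f W : M -> 'rV[R]_4) (m : M) (c : R) : Prop :=
  forall U X u (a1 a2 : 'rV[R]_2), local_param f U X -> U u -> X u = m ->
    let e1 := 'd (f \o X) u a1 in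
    let e2 := 'd (f \o X) u a2 in
    dot e1 e1 = 1 -> dot e2 e2 = 1 -> dot e1 e2 = 0 ->
    c = dot (covder f W X u a1) e1 + dot (covder f W X u a2) e2.

Definition constant_mean_curvature (R : realType) (M : topologicalType)
    (f N : M -> 'rV[R]_4) : Prop :=
  exists H : R, forall m, ~ singular f N m ->
    is_divergence f (nuh f N) m (- (2 * H)).

(* Since f is an immersion, g is C^1 as a curve in M if and only if it is
   continuous and f \o g is C^1.  The velocity may vanish, so that every
   piecewise C^1 curve on [0, 1] can be reparametrized, with the same length,
   as the restriction of such a curve. *)
Record C1_curve (R : realType) (M : topologicalType) (f : M -> 'rV[R]_4)
    (g : R -> M) : Prop := C1Curve {
  curve_continuous : continuous g ;
  curve_derivable : forall t, derivable (f \o g) t 1 ;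
  curve_C1 : continuous (derive1 (f \o g))
}.

Definition curve_length (R : realType) (M : topologicalType)
    (f : M -> 'rV[R]_4) (g : R -> M) : \bar R :=
  (\int[lebesgue_measure]_(t in `[0%R, 1%R]) (enorm (derive1 (f \o g) t))%:E)%E.

Definition surf_dist (R : realType) (M : topologicalType)
    (f : M -> 'rV[R]_4) (p q : M) : \bar R :=
  ereal_inf [set curve_length f g | g in
    [set g : R -> M | [/\ C1_curve f g, g 0 = p & g 1 = q]]].

Definition complete_surface (R : realType) (M : topologicalType)
    (f : M -> 'rV[R]_4) : Prop :=
  forall s : nat -> M,
    (forall e : R, 0 < e -> exists n0 : nat, forall i j : nat,
        (n0 <= i)%N -> (n0 <= j)%N -> (surf_dist f (s i) (s j) < e%:E)%E) ->
    exists p : M, forall e : R, 0 < e -> exists n0 : nat, forall i : nat,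
        (n0 <= i)%N -> (surf_dist f (s i) p < e%:E)%E.

(* Smooth maps of S^3 are represented by their smooth extensions to open
   neighbourhoods; a bijective smooth map preserving g is a diffeomorphism. *)
Record horizontal_isometry (R : realType) (Phi : 'rV[R]_4 -> 'rV[R]_4)
    : Prop := HorizontalIsometry {
  iso_smooth : exists O : set 'rV[R]_4,
    [/\ open O, @S3 R `<=` O & forall k, Ck k O Phi] ;
  iso_bij : set_bij (@S3 R) (@S3 R) Phi ;
  iso_metric : forall p u v, S3 p -> tangentS3 p u -> tangentS3 p v ->
    dot ('d Phi p u) ('d Phi p v) = dot u v ;
  iso_horizontal : forall p, S3 p ->
    'd Phi p @` horizontal p = horizontal (Phi p)
}.

Definition congruent (R : realType) (A B : set 'rV[R]_4) : Prop :=
  exists Phi, horizontal_isometry Phi /\ Phi @` A = B.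

Definition clifford_torus (R : realType) (rho : R) : set 'rV[R]_4 :=
  [set p | S3 p /\ p 0 0 ^+ 2 + p 0 1 ^+ 2 = rho ^+ 2].

(* Main.v *)
From HB Require Import structures.
Require Import Defs.
From mathcomp Require Import all_boot all_order all_algebra.
From mathcomp Require Import all_classical all_reals all_analysis.
From mathcomp Require Import measurable_realfun ring lra.

Set Implicit Arguments.
Unset Strict Implicit.
Unset Printing Implicit Defensive.

Import Order.TTheory GRing.Theory Num.Theory.
Import numFieldNormedType.Exports.

Local Open Scope classical_set_scope.
Local Open Scope ring_scope.

(** Write i p for the vertical field at p. If the surface is vertical with unit
    normal N, its tangent plane at p is spanned by i p and i N, because both are
    orthogonal to p and to N; in particular nu_h = N and no point is singular.
    The Weingarten equations then follow from three facts: the Hopf circles are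
    geodesics, the second fundamental form is symmetric, and the divergence of N
    is the constant h = -2H. They say that

      d p = x (i p) + y (i N)   gives   d N = x (i N) + y (i p + h i N)

    ([weingarten]). If lam is a root of lam^2 = 1 + h lam, then W = p + lam N
    satisfies d W = (x + lam y) i W, so W turns inside a fixed complex line,
    spanned by its value w at some point ([offline_constant], by connectedness).
    As W is orthogonal to i p and has scalar product 1 with p and constant length
    sqrt (1 + lam^2), the component of p in that line has constant length: the
    surface lies in a Clifford torus whose axis is the line of w
    ([axis_vector_coordinates]). Right multiplication by the conjugate of w / |w|
    commutes with the left multiplications defining i p, j p and k p, so it is an
    isometry preserving the horizontal distribution, and it brings the torus to
    the standard one of radius rho = 1 / sqrt (1 + lam^2).

    It remains to see that the surface is the whole torus. Any point of the torus
    is joined to a given point of the surface by a curve rotating the two complex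
    coordinates uniformly ([axis_torus_curve]), and such a curve lifts to the
    surface by completeness ([path_lifting]). Locally a lift exists because the
    point of the surface nearest to a point y of the torus sees y in a direction
    orthogonal to the tangent plane, which on a torus forces equality. A lift is
    continued by steps that are at least half as long as possible; the points
    reached form a Cauchy sequence for the intrinsic distance, and the local lift
    through the limit would contradict the choice of the steps if the end of the
    curve were not reached. *)

(** * Euclidean and complex linear algebra of R^4 *)


Lemma forall_ord4 (P : 'I_4 -> Prop) : P 0 -> P 1 -> P 2 -> P 3 -> forall i, P i.
Proof.
move=> P0 P1 P2 P3 [[|[|[|[|//]]]] lt_i4].
- by have -> : Ordinal lt_i4 = 0 by exact: val_inj.
- by have -> : Ordinal lt_i4 = 1 by exact: val_inj.
- by have -> : Ordinal lt_i4 = 2 by exact: val_inj.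
- by have -> : Ordinal lt_i4 = 3 by exact: val_inj.
Qed.

Lemma big_ord4 (R : nmodType) (F : 'I_4 -> R) :
  \sum_(i < 4) F i = F 0 + F 1 + F 2 + F 3.
Proof.
rewrite !big_ord_recr big_ord0 /= add0r.
by congr (F _ + F _ + F _ + F _); exact: val_inj.
Qed.

Lemma row4P (R : realType) (u v : 'rV[R]_4) :
  u 0 0 = v 0 0 -> u 0 1 = v 0 1 -> u 0 2 = v 0 2 -> u 0 3 = v 0 3 -> u = v.
Proof.
by move=> *; apply/rowP; apply: forall_ord4.
Qed.

Lemma dotE4 (R : realType) (u v : 'rV[R]_4) : dot u v =
  u 0 0 * v 0 0 + u 0 1 * v 0 1 + u 0 2 * v 0 2 + u 0 3 * v 0 3.
Proof. exact: big_ord4. Qed.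

Lemma quatE (R : realType) (a b c d : R) :
  (quat a b c d 0 0 = a) * (quat a b c d 0 1 = b) *
  (quat a b c d 0 2 = c) * (quat a b c d 0 3 = d).
Proof. by rewrite /quat !mxE. Qed.

Definition coordE := (quatE, mxE).

Lemma vfVE (R : realType) (p : 'rV[R]_4) :
  vfV p = quat (- p 0 1) (p 0 0) (- p 0 3) (p 0 2).
Proof. by apply: row4P; rewrite /vfV /qmul !quatE; ring. Qed.

Lemma vfE1E (R : realType) (p : 'rV[R]_4) :
  vfE1 p = quat (- p 0 2) (p 0 3) (p 0 0) (- p 0 1).
Proof. by apply: row4P; rewrite /vfE1 /qmul !quatE; ring. Qed.

Lemma vfE2E (R : realType) (p : 'rV[R]_4) :
  vfE2 p = quat (- p 0 3) (- p 0 2) (p 0 1) (p 0 0).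
Proof. by apply: row4P; rewrite /vfE2 /qmul !quatE; ring. Qed.

Lemma dotC (R : realType) n (u v : 'rV[R]_n) : dot u v = dot v u.
Proof. by apply: eq_bigr => i _; rewrite mulrC. Qed.

Lemma dotDl (R : realType) n (u v w : 'rV[R]_n) : dot (u + v) w = dot u w + dot v w.
Proof. by rewrite -big_split; apply: eq_bigr => i _; rewrite mxE mulrDl. Qed.

Lemma dotZl (R : realType) n (a : R) (u w : 'rV[R]_n) : dot (a *: u) w = a * dot u w.
Proof. by rewrite mulr_sumr; apply: eq_bigr => i _; rewrite mxE mulrA. Qed.

Lemma dotNl (R : realType) n (u w : 'rV[R]_n) : dot (- u) w = - dot u w.
Proof. by rewrite -scaleN1r dotZl mulN1r. Qed.

Lemma dotBl (R : realType) n (u v w : 'rV[R]_n) : dot (u - v) w = dot u w - dot v w.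
Proof. by rewrite dotDl dotNl. Qed.

Lemma dotDr (R : realType) n (u v w : 'rV[R]_n) : dot w (u + v) = dot w u + dot w v.
Proof. by rewrite ![dot w _]dotC dotDl. Qed.

Lemma dotZr (R : realType) n (a : R) (u w : 'rV[R]_n) : dot w (a *: u) = a * dot w u.
Proof. by rewrite ![dot w _]dotC dotZl. Qed.

Lemma dotNr (R : realType) n (u w : 'rV[R]_n) : dot w (- u) = - dot w u.
Proof. by rewrite ![dot w _]dotC dotNl. Qed.

Definition dotE := (dotDl, dotDr, dotZl, dotZr, dotNl, dotNr).

Lemma dot_ge0 (R : realType) n (u : 'rV[R]_n) : 0 <= dot u u.
Proof. by apply: sumr_ge0 => i _; rewrite -expr2 sqr_ge0. Qed.

Lemma dot_eq0 (R : realType) n (u : 'rV[R]_n) : dot u u = 0 -> u = 0.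
Proof.
move=> /eqP; rewrite psumr_eq0 => [/allP u0|i _]; last by rewrite -expr2 sqr_ge0.
apply/rowP => i; rewrite mxE; have := u0 i; rewrite mem_index_enum mulf_eq0 orbb.
by move=> /(_ isT)/eqP.
Qed.

Lemma enorm_unit (R : realType) n (u : 'rV[R]_n) : enorm u = 1 <-> dot u u = 1.
Proof.
rewrite /enorm; split=> [u1|->]; last by rewrite sqrtr1.
by rewrite -[LHS]sqr_sqrtr ?dot_ge0// u1 expr1n.
Qed.

(** The rows of an orthogonal matrix span the space because a left inverse of
    a square matrix is also a right inverse. *)
Lemma orthonormal_expansion (R : realType) n (A : 'M[R]_n) (v : 'rV[R]_n) :
  (forall i j, dot (row i A) (row j A) = (i == j)%:R) ->
  v = \sum_i dot v (row i A) *: row i A.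
Proof.
move=> orthA.
have /mulmx1C AtA : A *m A^T = 1%:M.
  apply/matrixP => i j; rewrite !mxE -orthA.
  by apply: eq_bigr => k _; rewrite !mxE.
rewrite -[LHS]mulmx1 -AtA mulmxA mulmx_sum_row.
apply: eq_bigr => i _; congr (_ *: _); rewrite mxE.
by apply: eq_bigr => k _; rewrite !mxE.
Qed.

Lemma orthonormal4_expansion (R : realType) (e0 e1 e2 e3 v : 'rV[R]_4) :
  dot e0 e0 = 1 -> dot e1 e1 = 1 -> dot e2 e2 = 1 -> dot e3 e3 = 1 ->
  dot e0 e1 = 0 -> dot e0 e2 = 0 -> dot e0 e3 = 0 ->
  dot e1 e2 = 0 -> dot e1 e3 = 0 -> dot e2 e3 = 0 ->
  v = dot v e0 *: e0 + dot v e1 *: e1 + dot v e2 *: e2 + dot v e3 *: e3.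
Proof.
move=> h00 h11 h22 h33 h01 h02 h03 h12 h13 h23.
pose e (i : 'I_4) := [:: e0; e1; e2; e3]`_i.
pose A := \matrix_(i < 4) e i.
have rowA i : row i A = e i by rewrite rowK.
rewrite {1}(@orthonormal_expansion _ _ A v) ?big_ord4 ?rowA //.
by apply: forall_ord4; apply: forall_ord4; rewrite !rowA //= dotC.
Qed.

Lemma vfV_linear (R : realType) : linear (@vfV R).
Proof. by move=> a u v; apply: row4P; rewrite !vfVE !coordE; ring. Qed.

HB.instance Definition _ (R : realType) :=
  GRing.isLinear.Build R 'rV[R]_4 'rV[R]_4 *:%R (@vfV R) (@vfV_linear R).

Lemma dot_vfV (R : realType) (u v : 'rV[R]_4) : dot (vfV u) (vfV v) = dot u v.
Proof. by rewrite !dotE4 !vfVE !quatE; ring. Qed.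

Lemma dot_vfVl (R : realType) (u v : 'rV[R]_4) : dot (vfV u) v = - dot u (vfV v).
Proof. by rewrite !dotE4 !vfVE !quatE; ring. Qed.

Lemma dot_vfV_self (R : realType) (u : 'rV[R]_4) : dot u (vfV u) = 0.
Proof. by rewrite !dotE4 !vfVE !quatE; ring. Qed.

Lemma vfVK (R : realType) (u : 'rV[R]_4) : vfV (vfV u) = - u.
Proof. by apply: row4P; rewrite !vfVE !coordE; ring. Qed.

(** Left multiplication by i makes R^4 a complex plane, and two
    vectors that are unitary for it give an orthonormal basis over R. *)
Lemma unitary_expansion (R : realType) (p n v : 'rV[R]_4) :
  dot p p = 1 -> dot n n = 1 -> dot n p = 0 -> dot n (vfV p) = 0 ->
  v = dot v p *: p + dot v (vfV p) *: vfV p + dot v n *: n + dot v (vfV n) *: vfV n.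
Proof.
move=> pp nn np nVp; apply: orthonormal4_expansion;
  rewrite ?dot_vfV ?dot_vfV_self //.
- by rewrite dotC.
- by rewrite dotC dot_vfVl nVp oppr0.
- by rewrite dotC.
- by rewrite dotC.
Qed.

Lemma unitary_tangent_expansion (R : realType) (p n v : 'rV[R]_4) :
  dot p p = 1 -> dot n n = 1 -> dot n p = 0 -> dot n (vfV p) = 0 ->
  dot v p = 0 -> dot v n = 0 ->
  v = dot v (vfV p) *: vfV p + dot v (vfV n) *: vfV n.
Proof.
move=> pp nn np nVp vp vn.
rewrite {1}(unitary_expansion v pp nn np nVp) vp vn.
by rewrite !scale0r add0r addr0.
Qed.

(** * Differentials of maps into row vectors *)



Lemma linear_rV_continuous (R : realType) n (W : normedModType R)
    (f : {linear 'rV[R]_n -> W}) : continuous f.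
Proof.
pose g i (v : 'rV[R]_n) : W := v 0 i *: f (delta_mx 0 i).
have -> : f = \sum_(i < n) g i :> ('rV[R]_n -> W).
  apply/funext => v; rewrite {1}[v]row_sum_delta linear_sum fct_sumE.
  by apply: eq_bigr => i _; rewrite linearZ.
move=> v; apply: differentiable_continuous; apply: differentiable_sum => i.
exact/differentiableZl/differentiable_coord.
Qed.

Lemma linear_rV_diff (R : realType) n (W : normedModType R)
    (f : {linear 'rV[R]_n -> W}) x : is_diff x f f.
Proof.
have fc := @linear_rV_continuous _ _ _ f.
by split; [exact: linear_differentiable|exact: diff_lin].
Qed.

Lemma differentiable_row (R : realType) (V : normedModType R) n
    (F : V -> 'rV[R]_n) x :
  (forall i, differentiable (fun y => F y 0 i) x) -> differentiable F x.
Proof.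
move=> dF.
have -> : F = \sum_(i < n) (fun y => F y 0 i *: (delta_mx 0 i : 'rV[R]_n)).
  by apply/funext => y; rewrite {1}[F y]row_sum_delta fct_sumE.
by apply: differentiable_sum => i; exact: differentiableZl.
Qed.

Lemma is_diff_linear (R : realType) (V : normedModType R) n
    (W : normedModType R) (L : {linear 'rV[R]_n -> W})
    (F : V -> 'rV[R]_n) x : differentiable F x ->
  is_diff x (fun y => L (F y)) (fun v => L ('d F x v)).
Proof.
move=> dF; have [dL dLE] := linear_rV_diff L (F x).
split; first exact: differentiable_comp.
by rewrite (diff_comp dF dL) dLE.
Qed.

Lemma is_diff_coord (R : realType) (V : normedModType R) n
    (F : V -> 'rV[R]_n) x i : differentiable F x ->
  is_diff x (fun y => F y 0 i) (fun v => 'd F x v 0 i).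
Proof.
pose c (A : 'rV[R]_n) : R := A 0 i.
have clin : linear c by move=> a u v; rewrite /c !mxE.
pose cM := GRing.isLinear.Build _ _ _ _ _ clin.
pose cL : {linear 'rV[R]_n -> R} := HB.pack c cM.
exact: (is_diff_linear cL).
Qed.

Lemma differentiable_dot (R : realType) (V : normedModType R) n
    (F G : V -> 'rV[R]_n) x : differentiable F x -> differentiable G x ->
  differentiable (fun y => dot (F y) (G y)) x.
Proof.
move=> dF dG.
have -> : (fun y => dot (F y) (G y)) =
    \sum_(i < n) (fun y => F y 0 i) * (fun y => G y 0 i).
  by apply/funext => y; rewrite fct_sumE.
apply: differentiable_sum => i; apply: differentiableM.
  by case: (is_diff_coord i dF).
by case: (is_diff_coord i dG).
Qed.

Lemma diff_dot (R : realType) (V : normedModType R) n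
    (F G : V -> 'rV[R]_n) x v : differentiable F x -> differentiable G x ->
  'd (fun y => dot (F y) (G y)) x v
    = dot ('d F x v) (G x) + dot (F x) ('d G x v).
Proof.
move=> dF dG; rewrite -deriveE; last exact: differentiable_dot.
have -> : (fun y => dot (F y) (G y)) =
    \sum_(i < n) (fun y => F y 0 i) * (fun y => G y 0 i).
  by apply/funext => y; rewrite fct_sumE.
have dFi i := @ex_diff _ _ _ _ _ _ _ (is_diff_coord i dF).
have dGi i := @ex_diff _ _ _ _ _ _ _ (is_diff_coord i dG).
rewrite derive_sum => [|i]; last by apply: derivableM; exact: diff_derivable.
rewrite /dot -big_split; apply: eq_bigr => i _.
rewrite deriveM ?deriveE //; try exact: diff_derivable.
have [_ dFE] := is_diff_coord i dF; have [_ dGE] := is_diff_coord i dG.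
have comb (p q p' q' : R) : p = p' -> q = q' ->
    F x 0 i *: q + G x 0 i *: p = p' * G x 0 i + F x 0 i * q'.
  by move=> -> ->; rewrite addrC; congr (_ + _); exact: mulrC.
exact: comb (congr1 (@^~ v) dFE) (congr1 (@^~ v) dGE).
Qed.

(** The differential depends only on the germ, by uniqueness of the first-order
    expansion. *)
Lemma near_eq_differentiable (R : realType) (V W : normedModType R)
    (f g : V -> W) x : (\near x, f x = g x) -> differentiable f x ->
  is_diff x g ('d f x).
Proof.
move=> fg df.
have gxE : g x = f x by rewrite (nbhs_singleton fg).
have gE : g \o shift x = cst (g x) + 'd f x +o_ 0 id.
  apply/eqaddoP => /= e e0.
  have /eqaddoP/(_ e e0) := diff_locally df.
  have fg0 : \forall h \near (0 : V), f (h + x) = g (h + x).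
    by have := fg; rewrite (near_shift 0 x) /= subr0.
  move=> fe; near=> h.
  have -> : (g \o shift x - (cst (g x) + 'd f x)) h =
            (f \o shift x - (cst (f x) + 'd f x)) h.
    rewrite !fctE /= gxE; congr (_ - _).
    by symmetry; near: h.
  by near: h.
have dfc : continuous ('d f x) by exact: diff_continuous.
have dgE : 'd g x = 'd f x :> (V -> W) by exact: diff_unique dfc gE.
split; last exact: dgE.
by apply/diff_locallyP; rewrite dgE.
Unshelve. all: by end_near. Qed.

(** Along a line, the chain rule reduces calculus in several variables to
    calculus in one variable. *)
Lemma is_derive_line (R : realType) (V W : normedModType R) (g : V -> W)
    (x a : V) (t : R) : differentiable g (x + t *: a) ->
  is_derive t 1 (fun s : R => g (x + s *: a)) ('d g (x + t *: a) a).
Proof.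
move=> dg.
have dl : is_diff t (fun s : R => x + s *: a) (fun s => s *: a).
  have -> : (fun s : R => x + s *: a) = cst x + *:%R^~ a by [].
  by apply: is_diff_eq; rewrite add0r.
have dgl : differentiable (g \o (fun s : R => x + s *: a)) t.
  by apply: differentiable_comp => //; case: dl.
split; first exact: (diff_derivable dgl).
rewrite -[LHS]/('D_1 (g \o (fun s : R => x + s *: a)) t) deriveE //.
by rewrite diff_comp // diff_val /= scale1r.
Qed.

Lemma continuous_line (R : realType) (V W : normedModType R) (g : V -> W)
    (x a : V) (t : R) : {for x + t *: a, continuous g} ->
  {for t, continuous (fun s : R => g (x + s *: a))}.
Proof.
move=> cg; apply: (@continuous_comp _ _ _ (fun s : R => x + s *: a) g) => //.
by apply: cvgD; [exact: cvg_cst|exact: scalel_continuous].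
Qed.

Lemma MVT_line (R : realType) (V : normedModType R) (g : V -> R) (x a : V) :
  (forall t, t \in `[0, 1] -> differentiable g (x + t *: a)) ->
  exists2 t, t \in `]0, 1[ & g (x + a) - g x = 'd g (x + t *: a) a.
Proof.
move=> dg.
have [|t|t t01 E] := @MVT R (fun s => g (x + s *: a))
    (fun s => 'd g (x + s *: a) a) 0 1 ltr01.
- move=> t t01; apply: is_derive_line; apply: dg.
  by apply: subset_itv_oo_cc t01.
- apply: continuous_in_subspaceT => s /set_mem s01; apply: continuous_line.
  by apply: differentiable_continuous; exact: dg.
- by exists t => //; move: E; rewrite scale1r scale0r addr0 subr0 mulr1.
Qed.

(** * Mean value theorem and critical points *)


Lemma ball_line (R : realType) (V : normedModType R) (x y z : V) (r t : R) :
  ball x r y -> ball x r z -> t \in `[0, 1] -> ball x r (y + t *: (z - y)).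
Proof.
rewrite -!ball_normE /= => xy xz; rewrite in_itv /= => /andP[t0 t1].
have -> : x - (y + t *: (z - y)) = (1 - t) *: (x - y) + t *: (x - z).
  have -> : z - y = (x - y) - (x - z) by rewrite opprB [RHS]addrC subrKA.
  by rewrite opprD addrA scalerBr opprB addrA addrAC scalerBl scale1r.
rewrite (le_lt_trans (ler_normD _ _))// !normrZ !ger0_norm ?subr_ge0//.
have [->|tn0] := eqVneq t 0; first by rewrite subr0 mul1r mul0r addr0.
have tgt0 : 0 < t by rewrite lt_neqAle eq_sym tn0.
have : (1 - t) * `|x - y| <= (1 - t) * r by rewrite ler_wpM2l ?subr_ge0// ltW.
have : t * `|x - z| < t * r by rewrite ltr_pM2l.
lra.
Qed.

Lemma MVT_ball (R : realType) (V : normedModType R) (g : V -> R) (x y z : V)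
    (r : R) : (forall w, ball x r w -> differentiable g w) ->
  ball x r y -> ball x r z ->
  exists2 w, ball x r w & g z - g y = 'd g w (z - y).
Proof.
move=> dg xy xz.
have [t t01|t t01] := @MVT_line _ _ g y (z - y).
  by apply: dg; exact: ball_line.
rewrite (addrC y) subrK => E; exists (y + t *: (z - y)) => //.
by apply: ball_line => //; exact: subset_itv_oo_cc t01.
Qed.

(** Each restriction to a line through the minimum has a critical point there. *)
Lemma diff_eq0_at_min (R : realType) (V : normedModType R) (g : V -> R)
    (x a : V) : (\near x, differentiable g x) ->
  (\forall y \near x, g x <= g y) -> 'd g x a = 0.
Proof.
move=> ndg gmin.
have lx : (fun t : R => x + t *: a) t @[t --> 0] --> x.
  have {2}-> : x = x + (0 : R) *: a by rewrite scale0r addr0.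
  by apply: cvgD; [exact: cvg_cst|exact: scalel_continuous].
have : \forall t \near (0 : R),
    differentiable g (x + t *: a) /\ g x <= g (x + t *: a).
  exact: lx _ (filterI ndg gmin).
move=> /nbhs_ballP[e /= e0 he].
have he' t : t \in `]-e, e[ -> differentiable g (x + t *: a) /\ g x <= g (x + t *: a).
  rewrite in_itv /= => te; apply: he; rewrite -ball_normE /= sub0r normrN ltr_norml.
  exact: te.
have d0 : is_derive (0 : R) 1 (fun t => g (x + t *: a)) 0.
  apply: (@derive1_at_min _ _ (- e) e); first by lra.
  - move=> t /he'[dgt _]; have [//] := is_derive_line dgt.
  - by rewrite in_itv /= oppr_lt0 e0.
  - by move=> t /he'[_]; rewrite scale0r addr0.
have := @is_derive_line _ _ _ g x a 0; rewrite scale0r addr0.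
move=> /(_ (nbhs_singleton ndg)) d1.
by rewrite -(@derive_val _ _ _ _ _ _ _ d1) (@derive_val _ _ _ _ _ _ _ d0).
Qed.

(** * Symmetry of second derivatives *)


Lemma is_diff_translate (R : realType) (V W : normedModType R) (g : V -> W)
    (c y : V) : differentiable g (y + c) ->
  is_diff y (fun z => g (z + c)) ('d g (y + c)).
Proof.
move=> dg.
have [dl dlE] : is_diff y (fun z : V => z + c) id.
  have -> : (fun z : V => z + c) = id + cst c by [].
  by apply: is_diff_eq; rewrite addr0.
split; first exact: (differentiable_comp (f := fun z => z + c)).
by rewrite -[LHS]/('d (g \o (fun z => z + c)) y : V -> W) (diff_comp dl dg) dlE.
Qed.

(** The mean value theorem, applied to the increment in direction b along
    direction a and then to the derivative in direction a along direction b. *)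
Lemma second_difference (R : realType) (V : normedModType R) (g ga : V -> R)
    (u a b : V) (s : R) (B : set V) : 0 <= s ->
  (forall x y, x \in `[0, s] -> y \in `[0, s] -> B (u + x *: a + y *: b)) ->
  (forall y, B y -> differentiable g y) ->
  (forall y, B y -> 'd g y a = ga y) ->
  (forall y, B y -> differentiable ga y) ->
  exists2 w, B w & g (u + s *: a + s *: b) - g (u + s *: a)
    - (g (u + s *: b) - g u) = s ^+ 2 * 'd ga w b.
Proof.
move=> s0 hB dg dgE dga.
have tsE (t : R) : t \in `[0, 1] -> t * s \in `[0, s].
  rewrite !in_itv /= => /andP[t0 t1]; rewrite mulr_ge0 //=.
  by rewrite -[leRHS]mul1r ler_wpM2r.
have s_in : s \in `[0, s] by rewrite in_itv /= s0 lexx.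
have o_in : 0 \in `[0, s] by rewrite in_itv /= s0 lexx.
have Bu t : t \in `[0, 1] -> B (u + t *: (s *: a)).
  by move=> /tsE t01; rewrite scalerA -[X in B X]addr0 -(scale0r b); exact: hB.
have Bub t : t \in `[0, 1] -> B (u + t *: (s *: a) + s *: b).
  by move=> /tsE t01; rewrite scalerA; exact: hB.
have dG t : t \in `[0, 1] ->
    is_diff (u + t *: (s *: a)) (fun y => g (y + s *: b) - g y)
      ('d g (u + t *: (s *: a) + s *: b) \- 'd g (u + t *: (s *: a))).
  move=> t01; have dg1 := is_diff_translate (dg _ (Bub _ t01)).
  have [dg1d dg1E] := dg1.
  have dg2 := dg _ (Bu _ t01).
  split; first exact: differentiableB.
  apply: etrans (diffB dg1d dg2) _.
  exact: (congr1 (fun z : V -> R => z \- 'd g (u + t *: (s *: a))) dg1E).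
have [t t01|t t01] := @MVT_line _ _ (fun y => g (y + s *: b) - g y) u (s *: a).
  by case: (dG t t01).
have {}t01 : t \in `[0, 1] by exact: subset_itv_oo_cc t01.
have [_ ->] := dG t t01 => -> /=.
have dgZ p : 'd g p (s *: a) = s * 'd g p a by rewrite linearZ.
rewrite !dgZ (dgE _ (Bu _ t01)) (dgE _ (Bub _ t01)) -mulrBr.
have dag' r : r \in `[0, 1] ->
    B (u + t *: (s *: a) + r *: (s *: b)).
  by move=> /tsE r01; rewrite !scalerA; apply: hB => //; exact: tsE.
have [r r01|r r01 ->] := @MVT_line _ _ ga (u + t *: (s *: a)) (s *: b).
  exact/dga/dag'.
have {}r01 : r \in `[0, 1] by exact: subset_itv_oo_cc r01.
exists (u + t *: (s *: a) + r *: (s *: b)); first exact: dag'.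
by rewrite linearZ /= expr2 -mulrA.
Qed.

Lemma eq_at_continuity_point (R : realType) (T : topologicalType)
    (P Q : T -> R) (u : T) :
  {for u, continuous P} -> {for u, continuous Q} ->
  (forall O, nbhs u O -> exists w w', [/\ O w, O w' & P w = Q w']) -> P u = Q u.
Proof.
move=> cP cQ PQ; apply/eqP; rewrite -subr_eq0 -normr_le0.
apply/ler_addgt0Pl => e e0; rewrite addr0.
have e20 : 0 < e / 2 by rewrite divr_gt0.
move/cvgrPdist_lt : cP => /(_ _ e20) nP.
move/cvgrPdist_lt : cQ => /(_ _ e20) nQ.
have [w [w' [[nPw _] [_ nQw'] eqw]]] := PQ _ (filterI nP nQ).
rewrite (le_trans (ler_distD (P w) _ _))// [leRHS]splitr.
by rewrite lerD ?ltW// eqw distrC.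
Qed.

Lemma small_parallelogram (R : realType) (V : normedModType R) (u a b : V)
    (O : set V) : nbhs u O -> exists2 s : R, 0 < s &
  forall x y, x \in `[0, s] -> y \in `[0, s] -> O (u + x *: a + y *: b).
Proof.
move=> /nbhs_ballP[r /= r0 hr].
pose s := r / (`|a| + `|b| + 1).
have D0 : 0 < `|a| + `|b| + 1 by rewrite ltr_wpDl// addr_ge0.
have s0 : 0 < s by rewrite divr_gt0.
exists s => // x y; rewrite !in_itv /= => /andP[x0 xs] /andP[y0 ys]; apply: hr.
rewrite -ball_normE /= -addrA opprD addrA subrr add0r normrN.
rewrite (le_lt_trans (ler_normD _ _))// !normrZ !ger0_norm//.
have : x * `|a| <= s * `|a| by rewrite ler_wpM2r.
have : y * `|b| <= s * `|b| by rewrite ler_wpM2r.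
have : s * (`|a| + `|b| + 1) = r by rewrite divfK// gt_eqF.
rewrite !mulrDr mulr1; lra.
Qed.

(** The second difference over a small parallelogram is symmetric in its two
    sides, and each order of the mixed derivative computes it. *)
Lemma mixed_derivatives (R : realType) (V : normedModType R)
    (g ga gb gab gba : V -> R) (U : set V) (u a b : V) : nbhs u U ->
  (forall y, U y -> differentiable g y) ->
  (forall y, U y -> 'd g y a = ga y) ->
  (forall y, U y -> 'd g y b = gb y) ->
  (forall y, U y -> differentiable ga y) ->
  (forall y, U y -> differentiable gb y) ->
  (forall y, U y -> 'd ga y b = gab y) ->
  (forall y, U y -> 'd gb y a = gba y) ->
  {for u, continuous gab} -> {for u, continuous gba} -> gab u = gba u.
Proof.
move=> nU dg gaE gbE dga dgb gabE gbaE cab cba.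
apply: (eq_at_continuity_point cab cba) => O nO.
have [s s0 hs] := small_parallelogram a b (filterI nO nU).
have hs' x y : x \in `[0, s] -> y \in `[0, s] -> (O `&` U) (u + x *: b + y *: a).
  by move=> xs ys; rewrite addrAC; exact: hs.
have [w [Ow Uw] Ew] := second_difference (ltW s0) hs (fun y '(conj _ h) => dg y h)
  (fun y '(conj _ h) => gaE y h) (fun y '(conj _ h) => dga y h).
have [w' [Ow' Uw'] Ew'] := second_difference (ltW s0) hs'
  (fun y '(conj _ h) => dg y h)
  (fun y '(conj _ h) => gbE y h) (fun y '(conj _ h) => dgb y h).
exists w, w'; split; [exact: Ow|exact: Ow'|].
have s20 : s ^+ 2 != 0 by rewrite expf_neq0// gt_eqF.
move: Ew Ew'; rewrite (gabE _ Uw) (gbaE _ Uw') => Ew Ew'.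
apply: (mulfI s20); rewrite -Ew -Ew' (addrAC u (s *: a)).
ring.
Qed.

(** * Immersions are locally bi-Lipschitz *)


Lemma coord_le_norm (R : realType) n (v : 'rV[R]_n) i : `|v 0 i| <= `|v|.
Proof.
rewrite [leRHS]/Num.Def.normr/= mx_normrE.
exact: (le_bigmax _ (fun k : 'I_1 * 'I_n => `|v k.1 k.2|) (0, i)).
Qed.

Lemma norm_le_coord (R : realType) n (v : 'rV[R]_n) (e : R) : 0 <= e ->
  (forall i, `|v 0 i| <= e) -> `|v| <= e.
Proof.
move=> e0 ve; rewrite [leLHS]/Num.Def.normr/= mx_normrE.
by apply: bigmax_le => // -[i j] _ /=; rewrite ord1.
Qed.

Lemma row_free_lin1_mx (R : realType) n m
    (L : {linear 'rV[R]_n -> 'rV[R]_m}) : injective L -> row_free (lin1_mx L).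
Proof.
move=> injL; rewrite -kermx_eq0; apply/eqP/row_matrixP => i.
by rewrite row0; apply: injL; rewrite linear0 -mul_rV_lin1 -row_mul mulmx_ker row0.
Qed.

(** A left inverse of an injective linear map is bounded. *)
Lemma injective_lower_bound (R : realType) n m
    (L : {linear 'rV[R]_n -> 'rV[R]_m}) : injective L ->
  exists2 k, 0 < k & forall v, k * `|v| <= `|L v|.
Proof.
move=> injL; have freeL := row_free_lin1_mx injL.
have [B LB] := row_freeP freeL.
have [k k0 hk] := linear_lipschitz (@linear_rV_continuous R _ _ (mulmxr B)).
exists k^-1; first by rewrite invr_gt0.
move=> v; rewrite ler_pdivrMl//.
by have := hk (L v); rewrite /= -mul_rV_lin1 -mulmxA LB mulmx1.
Qed.

Lemma linear_le_basis (R : realType) n (W : normedModType R)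
    (f g : {linear 'rV[R]_n -> W}) (d : R) (v : 'rV[R]_n) :
  (forall i, `|f (delta_mx 0 i) - g (delta_mx 0 i)| <= d) ->
  `|f v - g v| <= n%:R * d * `|v|.
Proof.
move=> fg.
have expand (h : {linear 'rV[R]_n -> W}) :
    h v = \sum_(i < n) v 0 i *: h (delta_mx 0 i).
  rewrite {1}[v]row_sum_delta linear_sum.
  by apply: eq_bigr => i _; rewrite linearZ.
rewrite (expand f) (expand g) -sumrB; apply: le_trans (ler_norm_sum _ _ _) _.
have step i : `|v 0 i *: f (delta_mx 0 i) - v 0 i *: g (delta_mx 0 i)| <= d * `|v|.
  by rewrite -scalerBr normrZ mulrC ler_pM ?coord_le_norm.
apply: le_trans (ler_sum _ (fun i _ => step i)) _.
by rewrite sumr_const card_ord -[leLHS]mulr_natl mulrA.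
Qed.

(** In finite dimension, continuity of the finitely many partial derivatives gives
    continuity of the differential in operator norm. *)
Lemma diff_near_uniform (R : realType) n (W : normedModType R)
    (F : 'rV[R]_n -> W) (u : 'rV[R]_n) (e : R) : 0 < e ->
  (\forall y \near u, differentiable F y) ->
  (forall v, {for u, continuous ('D_v F)}) ->
  \forall y \near u, forall v, `|'d F y v - 'd F u v| <= e * `|v|.
Proof.
move=> e0 dF cdF.
pose d := e / n.+1%:R.
have d0 : 0 < d by rewrite divr_gt0.
pose close i y := `|'D_(delta_mx 0 i) F u - 'D_(delta_mx 0 i) F y| < d.
have near_d : \forall y \near u, forall i : 'I_n, close i y.
  apply: (@filter_forall _ 'I_n close (nbhs u) _) => i.
  by have /cvgrPdist_lt/(_ _ d0) := cdF (delta_mx 0 i).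
have dFu := nbhs_singleton dF.
apply: filterS2 dF near_d => y dFy close_y v.
have step i : `|'d F y (delta_mx 0 i) - 'd F u (delta_mx 0 i)| <= d.
  have swap (p q p' q' : W) : p = p' -> q = q' -> `|q - p| < d -> `|p' - q'| <= d.
    by move=> -> ->; rewrite distrC => /ltW.
  exact: swap (deriveE _ dFy) (deriveE _ dFu) (close_y i).
apply: le_trans (linear_le_basis v step) _.
rewrite ler_wpM2r ?normr_ge0 // /d mulrCA ler_piMr ?(ltW e0) //.
by rewrite ler_pdivrMr // mul1r ler_nat.
Qed.

(** Near a point the map differs from its injective differential by a small
    Lipschitz error, which the lower bound for the differential absorbs. *)
Lemma immersion_lower_bound (R : realType) n m (F : 'rV[R]_n -> 'rV[R]_m)
    (u : 'rV[R]_n) : (\forall y \near u, differentiable F y) ->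
  (forall v, {for u, continuous ('D_v F)}) -> injective ('d F u) ->
  exists2 c, 0 < c & \forall r \near 0^'+, forall x y, ball u r x -> ball u r y ->
    c * `|x - y| <= `|F x - F y|.
Proof.
move=> dF cdF inj.
have [k k0 hk] := injective_lower_bound inj.
have k20 : 0 < k / 2 by rewrite divr_gt0.
exists (k / 2) => //.
have near_u : nbhs u [set y | differentiable F y /\
    forall v, `|'d F y v - 'd F u v| <= k / 2 * `|v|].
  exact: filterI dF (diff_near_uniform k20 dF cdF).
have [r /= r0 hr] := (nbhs_ballP _ _).1 near_u.
near=> s => x y ux uy.
have sr : s <= r by near: s; apply: nbhs_right_le.
have hr' w : ball u s w -> differentiable F w /\
    forall v, `|'d F w v - 'd F u v| <= k / 2 * `|v|.
  by move=> usw; apply: hr; exact: le_ball usw.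
have err : `|F x - F y - 'd F u (x - y)| <= k / 2 * `|x - y|.
  apply: norm_le_coord => [|i]; first by rewrite mulr_ge0// ltW.
  have [w uw|w uw] := @MVT_ball _ _ (fun z => F z 0 i) u y x s _ uy ux.
    by have [dw _] := hr' _ uw; case: (is_diff_coord i dw).
  have [dw near_w] := hr' _ uw; have [_ ->] := is_diff_coord i dw.
  move=> E; rewrite !mxE E.
  apply: le_trans (near_w (x - y)).
  by have := coord_le_norm ('d F w (x - y) - 'd F u (x - y)) i; rewrite !mxE.
have := hk (x - y).
have := ler_normB (F x - F y) (F x - F y - 'd F u (x - y)).
rewrite opprB addrC subrK => h1 h2.
have := le_trans h2 (le_trans h1 (lerD (lexx _) err)).
by rewrite {1}[k]splitr mulrDl lerD2r.
Unshelve. all: by end_near. Qed.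

(** * The tangent plane and the normal of a vertical surface *)


Lemma continuous_dot (R : realType) (T : topologicalType) n
    (F G : T -> 'rV[R]_n) (x : T) :
  {for x, continuous F} -> {for x, continuous G} ->
  {for x, continuous (fun y => dot (F y) (G y))}.
Proof.
move=> cF cG.
pose c i (v : 'rV[R]_n) : R := v 0 i.
have cc i : continuous (c i) by exact: coord_continuous.
have -> : (fun y => dot (F y) (G y)) =
    \sum_(i < n) (fun y => c i (F y) * c i (G y)) :> (T -> R).
  by apply/funext => y; rewrite fct_sumE.
elim/big_ind: _ => [|g h cg ch|i _]; first exact: cvg_cst.
  exact: cvgD cg ch.
apply: cvgM; first exact: continuous_comp cF (cc i _).
exact: continuous_comp cG (cc i _).
Qed.

Lemma differentiable_scale (R : realType) (V : normedModType R) n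
    (s : V -> R) (F : V -> 'rV[R]_n) x :
  differentiable s x -> differentiable F x ->
  differentiable (fun y => s y *: F y) x.
Proof.
move=> ds dF; apply: differentiable_row => i.
have -> : (fun y => (s y *: F y) 0 i) = s * (fun y => F y 0 i).
  by apply/funext => y; rewrite mxE.
by apply: differentiableM => //; have [] := is_diff_coord i dF.
Qed.

Lemma diff_near_cst (R : realType) (V W : normedModType R) (g : V -> W)
    (c : W) (x v : V) : (\forall y \near x, g y = c) -> 'd g x v = 0.
Proof.
move=> gc; have cg : \near x, cst c x = g x.
  by apply: filterS gc => y ->.
have [_ ->] := near_eq_differentiable cg (differentiable_cst c x).
by rewrite diff_cst.
Qed.

Lemma injective_linear_surjective (R : realType) n
    (L : {linear 'rV[R]_n -> 'rV[R]_n}) : injective L ->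
  forall w, exists v, L v = w.
Proof.
move=> injL w.
have unitL : lin1_mx L \in unitmx by rewrite -row_free_unit row_free_lin1_mx.
by exists (w *m invmx (lin1_mx L)); rewrite -mul_rV_lin1 mulmxKV.
Qed.

Lemma nonzero_differentiable_enorm (R : realType) (V : normedModType R) n
    (F : V -> 'rV[R]_n) x : differentiable F x -> 0 < dot (F x) (F x) ->
  differentiable (fun y => enorm (F y)) x.
Proof.
move=> dF F0.
have dq := differentiable_dot dF dF.
have ds : differentiable (@Num.sqrt R) (dot (F x) (F x)).
  by apply/derivable1_diffP; have [] := is_derive1_sqrt F0.
exact: (differentiable_comp (f := fun y => dot (F y) (F y)) dq ds).
Qed.

Lemma chart_tangent (R : realType) (M : topologicalType) (f : M -> 'rV[R]_4)
    U X u a : local_param f U X -> U u -> tangent f (X u) ('d (f \o X) u a).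
Proof. by move=> cX Uu; exists U, X, u, a. Qed.

Section VerticalSurface.
Variables (R : realType) (M : topologicalType) (f N : M -> 'rV[R]_4).
Hypothesis f_S3 : forall m, S3 (f m).
Hypothesis normalN : unit_normal f N.
Hypothesis vertf : vertical f.

Lemma surface_dot m : dot (f m) (f m) = 1.
Proof. exact/enorm_unit/f_S3. Qed.

Lemma normal_dot m : dot (N m) (N m) = 1.
Proof. exact/enorm_unit/(normal_unit normalN). Qed.

Lemma normal_dot_surface m : dot (N m) (f m) = 0.
Proof. exact: (normal_S3 normalN). Qed.

Lemma normal_dot_vertical m : dot (N m) (vfV (f m)) = 0.
Proof. exact: (normal_orth normalN). Qed.

Lemma nuh_vertical : nuh f N = N.
Proof.
apply/funext => m.
by rewrite /nuh /hnormal normal_dot_vertical scale0r subr0 (normal_unit normalN)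
  invr1 scale1r.
Qed.

Lemma nonsingular_vertical m : ~ singular f N m.
Proof.
rewrite /singular /hnormal /= normal_dot_vertical scale0r subr0 => N0.
have := normal_dot m; rewrite N0 /dot big1 => [/eqP|i _].
  by rewrite eq_sym oner_eq0.
by rewrite mxE mul0r.
Qed.

Section Chart.
Variables (U : set 'rV[R]_2) (X : 'rV[R]_2 -> M).
Hypothesis chartX : local_param f U X.

Lemma chart_nbhs u : U u -> nbhs u U.
Proof. by move=> Uu; apply: open_nbhs_nbhs; split => //; exact: lp_open chartX. Qed.

Lemma chart_differentiable u : U u -> differentiable (f \o X) u.
Proof. by move=> Uu; apply: (lp_C2 chartX).1. Qed.

Lemma chart_D_differentiable v u : U u -> differentiable ('D_v (f \o X)) u.
Proof. by move=> Uu; apply: ((lp_C2 chartX).2 v).1. Qed.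

Lemma chart_DD_continuous v w u : U u ->
  {for u, continuous ('D_w ('D_v (f \o X)))}.
Proof. by move=> Uu; apply: ((lp_C2 chartX).2 v).2. Qed.

Lemma chart_tangent_S3 u a : U u -> dot ('d (f \o X) u a) (f (X u)) = 0.
Proof.
move=> Uu; have df := chart_differentiable Uu.
have := diff_dot a df df.
rewrite (@diff_near_cst _ _ _ _ (1 : R)); last by apply: filterE => y; exact: surface_dot.
move/esym; rewrite [dot ((f \o X) u) _]dotC -mulr2n.
by move/eqP; rewrite mulrn_eq0 => /eqP.
Qed.

Lemma chart_tangent_normal u a : U u -> dot (N (X u)) ('d (f \o X) u a) = 0.
Proof. by move=> Uu; exact: (normal_orth normalN (chart_tangent a chartX Uu)). Qed.

Lemma chart_tangent_expansion u a : U u ->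
  'd (f \o X) u a =
    dot ('d (f \o X) u a) (vfV (f (X u))) *: vfV (f (X u)) +
    dot ('d (f \o X) u a) (vfV (N (X u))) *: vfV (N (X u)).
Proof.
move=> Uu; apply: unitary_tangent_expansion.
- exact: surface_dot.
- exact: normal_dot.
- exact: normal_dot_surface.
- exact: normal_dot_vertical.
- exact: chart_tangent_S3.
- by rewrite dotC; exact: chart_tangent_normal.
Qed.

(** The tangent plane is two-dimensional and lies in the plane orthogonal to
    the position and to the normal, so it is that plane. *)
Lemma chart_tangent_plane u (x y : R) : U u ->
  exists a, 'd (f \o X) u a = x *: vfV (f (X u)) + y *: vfV (N (X u)).
Proof.
move=> Uu.
(* The columns are i p and i N, so that the linear map below reads the
   coordinates of a tangent vector in that basis. *)
pose P := \matrix_(i < 4, j < 2)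
  (if j == 0 then vfV (f (X u)) 0 i else vfV (N (X u)) 0 i).
pose L := mulmxr P \o 'd (f \o X) u.
have L0 a : L a 0 0 = dot ('d (f \o X) u a) (vfV (f (X u))).
  by rewrite mxE; apply: eq_bigr => i _; rewrite mxE.
have L1 a : L a 0 1 = dot ('d (f \o X) u a) (vfV (N (X u))).
  by rewrite mxE; apply: eq_bigr => i _; rewrite mxE.
have injL : injective L.
  move=> a b /rowP ab; apply: (lp_immersion chartX Uu).
  rewrite (chart_tangent_expansion a Uu) (chart_tangent_expansion b Uu).
  by rewrite -!L0 -!L1 !ab.
have [a La] : exists a, L a = \row_i [:: x; y]`_i.
  exact: injective_linear_surjective.
by exists a; rewrite (chart_tangent_expansion a Uu) -L0 -L1 La !mxE.
Qed.

Lemma chart_normal_continuous u : U u -> {for u, continuous (N \o X)}.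
Proof.
move=> Uu; apply: continuous_comp; first exact: (lp_continuous chartX).
exact: (normal_continuous normalN).
Qed.

(** Along a chart the normal is obtained algebraically from the first
    derivatives of the immersion: it is -i times the normalised horizontal
    part of any coordinate direction that is horizontal at the given point. *)
Lemma chart_normal_differentiable u : U u -> differentiable (N \o X) u.
Proof.
move=> Uu; have [a] := chart_tangent_plane 0 1 Uu.
rewrite scale0r add0r scale1r => da.
pose D := 'D_a (f \o X).
pose W y := D y - dot (D y) (vfV ((f \o X) y)) *: vfV ((f \o X) y).
pose b y := dot (D y) (vfV ((N \o X) y)).
have DE y : U y -> D y = 'd (f \o X) y a.
  by move=> Uy; apply: deriveE; exact: chart_differentiable.
have WE y : U y -> W y = b y *: vfV ((N \o X) y).
  move=> Uy; have := chart_tangent_expansion a Uy; rewrite -DE // => E.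
  by rewrite /W {1}E addrAC subrr add0r.
have WW y : U y -> dot (W y) (W y) = b y ^+ 2.
  by move=> Uy; rewrite WE // !dotE dot_vfV normal_dot mulr1 expr2.
have dfX := chart_differentiable Uu.
have dD : differentiable D u by exact: chart_D_differentiable.
have dVf : differentiable (fun y => vfV ((f \o X) y)) u.
  by have [] := is_diff_linear (@vfV R) dfX.
have dW : differentiable W u.
  apply: differentiableB => //; apply: differentiable_scale => //.
  exact: differentiable_dot.
have bu : b u = 1 by rewrite /b DE // da dot_vfV normal_dot.
have cb : {for u, continuous b}.
  apply: continuous_dot; first exact: differentiable_continuous.
  apply: continuous_comp; first exact: chart_normal_continuous.
  exact: linear_rV_continuous.
have b0 : \forall y \near u, 0 < b y.
  by apply: (cvgr_gt _ cb); rewrite bu.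
have : \forall y \near u, (enorm (W y))^-1 *: - vfV (W y) = (N \o X) y.
  apply: filterS2 (chart_nbhs Uu) b0 => y Uy by0.
  rewrite /enorm WW // sqrtr_sqr gtr0_norm // WE // linearZ /= vfVK.
  by rewrite !scalerN opprK scalerA mulVf ?gt_eqF // scale1r.
move=> /near_eq_differentiable []//.
apply: differentiable_scale.
  have W0 : 0 < dot (W u) (W u) by rewrite WW // bu expr1n.
  apply: differentiableV; first exact: nonzero_differentiable_enorm.
  by rewrite gt_eqF // sqrtr_gt0.
by apply: differentiableN; have [] := is_diff_linear (@vfV R) dW.
Qed.

End Chart.
End VerticalSurface.

(** * The Weingarten equations *)


Lemma dot0l (R : realType) n (v : 'rV[R]_n) : dot 0 v = 0.
Proof. by rewrite -(scale0r v) dotZl mul0r. Qed.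

Lemma diff_dot_cst (R : realType) (V : normedModType R) n (c : 'rV[R]_n)
    (F : V -> 'rV[R]_n) x v : differentiable F x ->
  'd (fun y => dot c (F y)) x v = dot c ('d F x v).
Proof.
move=> dF; have dc := @differentiable_cst _ _ _ c x.
have drop0 w z : w = 0 -> dot w (F x) + dot c z = dot c z.
  by move=> ->; rewrite dot0l add0r.
apply: etrans (diff_dot v dc dF) (drop0 _ _ _).
by rewrite diff_cst.
Qed.

Lemma diff_dot_near_cst (R : realType) (V : normedModType R) n
    (F G : V -> 'rV[R]_n) (c : R) x v : differentiable F x -> differentiable G x ->
  (\forall y \near x, dot (F y) (G y) = c) ->
  dot ('d F x v) (G x) + dot (F x) ('d G x v) = 0.
Proof.
move=> dF dG FGc; apply: etrans (esym (diff_dot v dF dG)) _.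
exact: diff_near_cst FGc.
Qed.

Lemma orthogonal_of_unit (R : realType) n (p q : 'rV[R]_n) :
  dot p q + dot q p = 0 -> dot p q = 0.
Proof. by rewrite [dot q p]dotC -mulr2n => /eqP; rewrite mulrn_eq0 => /eqP. Qed.

Lemma addr_eq0_right (V : zmodType) (x y : V) : x + y = 0 -> y = 0 -> x = 0.
Proof. by move=> xy y0; rewrite y0 addr0 in xy. Qed.

Lemma differentiable_dot_cst (R : realType) (V : normedModType R) n (c : 'rV[R]_n)
    (F : V -> 'rV[R]_n) x : differentiable F x ->
  differentiable (fun y => dot c (F y)) x.
Proof. exact: (differentiable_dot (differentiable_cst c x)). Qed.

Lemma mixed_derivatives_chart (R : realType) (M : topologicalType)
    (f : M -> 'rV[R]_4) U X (u a b : 'rV[R]_2) (c : 'rV[R]_4) :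
  local_param f U X -> U u ->
  dot c ('D_b ('D_a (f \o X)) u) = dot c ('D_a ('D_b (f \o X)) u).
Proof.
move=> cX Uu; have dF := chart_differentiable cX.
have dDF v y := @chart_D_differentiable _ _ _ _ _ cX v y.
have DE v y : U y -> 'd (fun z => dot c ((f \o X) z)) y v = dot c ('D_v (f \o X) y).
  by move=> Uy; rewrite diff_dot_cst ?deriveE //; exact: dF.
have DDE v w y : U y -> 'd (fun z => dot c ('D_v (f \o X) z)) y w
    = dot c ('D_w ('D_v (f \o X)) y).
  by move=> Uy; rewrite diff_dot_cst ?deriveE //; exact: dDF.
apply: (mixed_derivatives (chart_nbhs cX Uu) (g := fun y => dot c ((f \o X) y))
  (ga := fun y => dot c ('D_a (f \o X) y))
  (gb := fun y => dot c ('D_b (f \o X) y))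
  (gab := fun y => dot c ('D_b ('D_a (f \o X)) y))
  (gba := fun y => dot c ('D_a ('D_b (f \o X)) y)) (a := a) (b := b)).
- by move=> y Uy; apply: differentiable_dot_cst; exact: dF.
- exact: DE.
- exact: DE.
- by move=> y Uy; apply: differentiable_dot_cst; exact: dDF.
- by move=> y Uy; apply: differentiable_dot_cst; exact: dDF.
- exact: DDE.
- exact: DDE.
- by apply: continuous_dot; [exact: cst_continuous|exact: chart_DD_continuous cX _ _ _ Uu].
- by apply: continuous_dot; [exact: cst_continuous|exact: chart_DD_continuous cX _ _ _ Uu].
Qed.

Section Weingarten.
Variables (R : realType) (M : topologicalType) (f N : M -> 'rV[R]_4).
Hypothesis f_S3 : forall m, S3 (f m).
Hypothesis normalN : unit_normal f N.
Hypothesis vertf : vertical f.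
Variables (U : set 'rV[R]_2) (X : 'rV[R]_2 -> M) (h : R).
Hypothesis chartX : local_param f U X.
Hypothesis divN : forall m, is_divergence f N m h.

Let F := f \o X.
Let n := N \o X.

Let dF u : U u -> differentiable F u.
Proof. exact: (chart_differentiable chartX). Qed.

Let dn u : U u -> differentiable n u.
Proof. exact: (chart_normal_differentiable f_S3). Qed.

(** The second fundamental form is symmetric: both sides are, up to sign, the
    normal component of a second derivative of the immersion. *)
Lemma shape_symmetric u a b : U u ->
  dot ('d n u a) ('d F u b) = dot ('d n u b) ('d F u a).
Proof.
move=> Uu.
have key v w : dot ('d n u v) ('d F u w) = - dot (n u) ('D_v ('D_w F) u).
  have dDF : differentiable ('D_w F) u by exact: (chart_D_differentiable chartX w Uu).
  have comb (t : R) (p q r q' r' : 'rV[R]_4) : t = dot p q + dot (n u) r ->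
      t = 0 -> q = q' -> r' = r -> dot p q' = - dot (n u) r'.
    by move=> tE t0 <- ->; apply/eqP; rewrite -addr_eq0 -tE t0.
  apply: comb (diff_dot v (dn Uu) dDF) _ (deriveE w (dF Uu)) (deriveE v dDF).
  apply: (@diff_near_cst _ _ _ _ (0 : R)).
  apply: filterS (chart_nbhs chartX Uu) => y Uy.
  by rewrite (deriveE w (dF Uy)); exact: (chart_tangent_normal normalN chartX w Uy).
apply: etrans (key a b) (etrans (congr1 -%R _) (esym (key b a))).
exact: (mixed_derivatives_chart _ _ _ chartX Uu).
Qed.

Lemma diff_normal_normal u a : U u -> dot ('d n u a) (n u) = 0.
Proof.
move=> Uu; apply: orthogonal_of_unit.
apply: (diff_dot_near_cst (c := 1) a (dn Uu) (dn Uu)).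
by apply: filterE => y; exact: (normal_dot normalN).
Qed.

Lemma diff_normal_position u a : U u -> dot ('d n u a) (F u) = 0.
Proof.
move=> Uu; have := chart_tangent_normal normalN chartX a Uu.
apply: addr_eq0_right; apply: (diff_dot_near_cst (c := 0) a (dn Uu) (dF Uu)).
by apply: filterE => y; exact: (normal_dot_surface normalN).
Qed.

Lemma diff_normal_vertical u a : U u ->
  dot ('d n u a) (vfV (F u)) = dot ('d F u a) (vfV (n u)).
Proof.
move=> Uu; have [dVF dVFE] := is_diff_linear (@vfV R) (dF Uu).
have comb (p q : 'rV[R]_4) (t : 'rV[R]_4) : dot p (vfV (F u)) + dot (n u) q = 0 ->
    q = vfV t -> dot p (vfV (F u)) = dot t (vfV (n u)).
  by move=> /eqP; rewrite addr_eq0 => /eqP -> ->; rewrite -dot_vfVl dotC.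
apply: comb (congr1 (@^~ a) dVFE).
apply: (diff_dot_near_cst (c := 0) a (dn Uu) dVF).
by apply: filterE => y; exact: (normal_dot_vertical normalN vertf).
Qed.

(** The coefficients of d N in the basis (i p, i N) of the tangent plane: the
    derivative along i p has no component on i p since Hopf circles are
    geodesics, the mixed coefficient is <i N, i N> = 1 by differentiation of
    <N, i p> = 0, and the trace is the divergence. *)
Lemma weingarten u a x y : U u ->
  'd F u a = x *: vfV (F u) + y *: vfV (n u) ->
  'd n u a = x *: vfV (n u) + y *: (vfV (F u) + h *: vfV (n u)).
Proof.
move=> Uu dFa.
have FF : dot (F u) (F u) = 1 by exact: (surface_dot f_S3).
have nn : dot (n u) (n u) = 1 by exact: (normal_dot normalN).
have nF : dot (n u) (F u) = 0 by exact: (normal_dot_surface normalN).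
have nVF : dot (n u) (vfV (F u)) = 0 by exact: (normal_dot_vertical normalN vertf).
have [a1 dF1] := chart_tangent_plane f_S3 normalN vertf chartX 1 0 Uu.
have [a2 dF2] := chart_tangent_plane f_S3 normalN vertf chartX 0 1 Uu.
have {}dF1 : 'd F u a1 = vfV (F u) by apply: etrans dF1 _; rewrite scale0r scale1r addr0.
have {}dF2 : 'd F u a2 = vfV (n u) by apply: etrans dF2 _; rewrite scale0r scale1r add0r.
have aE : a = x *: a1 + y *: a2.
  apply: (lp_immersion chartX Uu).
  apply: etrans dFa (esym _); apply: etrans (linearP ('d F u) _ _ _) _.
  by congr (_ *: _ + _) => //; apply: etrans (linearZ _ _) _; congr (_ *: _).
have dn1VF : dot ('d n u a1) (vfV (F u)) = 0.
  apply: etrans (diff_normal_vertical _ Uu) _.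
  by apply: etrans (congr1 (fun z => dot z (vfV (n u))) dF1) _; rewrite dot_vfV dotC.
have dn2VF : dot ('d n u a2) (vfV (F u)) = 1.
  apply: etrans (diff_normal_vertical _ Uu) _.
  by apply: etrans (congr1 (fun z => dot z (vfV (n u))) dF2) _; rewrite dot_vfV.
have dn1Vn : dot ('d n u a1) (vfV (n u)) = 1.
  apply: etrans (congr1 (dot _) (esym dF2)) _.
  apply: etrans (shape_symmetric _ _ Uu) _.
  exact: etrans (congr1 (dot _) dF1) _.
have dn2Vn : dot ('d n u a2) (vfV (n u)) = h.
  have e11 : dot ('d F u a1) ('d F u a1) = 1 by rewrite dF1 dot_vfV.
  have e22 : dot ('d F u a2) ('d F u a2) = 1 by rewrite dF2 dot_vfV.
  have e12 : dot ('d F u a1) ('d F u a2) = 0 by rewrite dF1 dF2 dot_vfV dotC.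
  have comb (v1 v2 w1 w2 : 'rV[R]_4) : w1 = vfV (F u) -> w2 = vfV (n u) ->
      dot v1 (vfV (F u)) = 0 ->
      h = dot (v1 - dot v1 (F u) *: F u) w1 + dot (v2 - dot v2 (F u) *: F u) w2 ->
      dot v2 (vfV (n u)) = h.
    move=> -> -> v1VF ->; rewrite !dotE v1VF dot_vfV_self.
    have -> : dot (F u) (vfV (n u)) = 0 by rewrite dotC dot_vfVl nVF oppr0.
    by rewrite !(mulr0, oppr0, add0r, addr0).
  exact: comb dF1 dF2 dn1VF (divN chartX Uu erefl e11 e22 e12).
have expand v : 'd n u v = dot ('d n u v) (vfV (F u)) *: vfV (F u) +
    dot ('d n u v) (vfV (n u)) *: vfV (n u).
  by apply: unitary_tangent_expansion => //;
    [exact: diff_normal_position|exact: diff_normal_normal].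
have dn1 : 'd n u a1 = vfV (n u).
  by apply: etrans (expand a1) _; rewrite dn1VF dn1Vn scale0r add0r scale1r.
have dn2 : 'd n u a2 = vfV (F u) + h *: vfV (n u).
  by apply: etrans (expand a2) _; rewrite dn2VF dn2Vn scale1r.
rewrite aE; apply: etrans (linearP ('d n u) _ _ _) _.
by congr (_ *: _ + _) => //; apply: etrans (linearZ _ _) _; congr (_ *: _).
Qed.
End Weingarten.

(** * A conserved complex line *)


(** Charts are open maps, so properties that hold near a parameter hold near its
    image. *)
Lemma chart_near (R : realType) (M : topologicalType) (f : M -> 'rV[R]_4) U X u
    (P : set M) : local_param f U X -> U u ->
  (\forall v \near u, P (X v)) -> nbhs (X u) P.
Proof.
move=> cX Uu nP.
have [r /= r0 hr] := (nbhs_ballP _ _).1 (filterI (chart_nbhs cX Uu) nP).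
rewrite nbhsE; exists (X @` ball u r).
  split; last by exists u => //; exact: ballxx.
  apply: (lp_open_map cX); first exact: ball_open.
  by move=> v /hr[].
by move=> _ [v /hr[_ Pv] <-].
Qed.

Lemma connected_locally_constant (M : topologicalType) (T : Type) (g : M -> T)
    (m0 m : M) : connected [set: M] ->
  (forall p, \forall q \near p, g q = g p) -> g m = g m0.
Proof.
move=> connM gloc.
have opn (c : T) : open [set p | g p = c].
  by rewrite openE => p <-; exact: gloc.
have opnC (c : T) : open (~` [set p | g p = c]).
  rewrite openE => p gp; rewrite /interior.
  by apply: filterS (gloc p) => q /= ->.
suff : [set p | g p = g m0] = setT.
  by move=> /seteqP[_ /(_ m I)].
apply: connM; first by exists m0.
- by exists [set p | g p = g m0]; rewrite ?setTI.
- exists [set p | g p = g m0]; rewrite ?setTI //.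
  by rewrite -[X in closed X]setCK; exact: open_closedC.
Qed.

Lemma diff0_locally_constant (R : realType) (V : normedModType R) (g : V -> R)
    (x : V) : (\forall y \near x, differentiable g y /\ forall a, 'd g y a = 0) ->
  \forall y \near x, g y = g x.
Proof.
move=> dg; have [r /= r0 hr] := (nbhs_ballP _ _).1 dg.
apply/nbhs_ballP; exists r => // y xy /=.
have [w /hr[dw]|w /hr[_ dw]] := @MVT_ball _ _ g x x y r _ (ballxx x r0) xy.
  by [].
by rewrite dw => /eqP; rewrite subr_eq0 => /eqP.
Qed.

(** The square of the norm of the component of v orthogonal to the complex
    line spanned by w, up to the factor |w|^2. *)
Definition offline (R : realType) (w v : 'rV[R]_4) : R :=
  dot v (vfE1 w) ^+ 2 + dot v (vfE2 w) ^+ 2.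

Lemma offline_self (R : realType) (w : 'rV[R]_4) : offline w w = 0.
Proof.
rewrite /offline !dotE4 vfE1E vfE2E !quatE; ring.
Qed.

Lemma offline_eq0 (R : realType) (w v : 'rV[R]_4) : offline w v = 0 ->
  dot v (vfE1 w) = 0 /\ dot v (vfE2 w) = 0.
Proof.
move/eqP; rewrite paddr_eq0 ?sqr_ge0// !sqrf_eq0.
by move=> /andP[/eqP-> /eqP->].
Qed.

Lemma dot_vfV_vfE1 (R : realType) (v w : 'rV[R]_4) :
  dot (vfV v) (vfE1 w) = - dot v (vfE2 w).
Proof. by rewrite !dotE4 vfVE vfE1E vfE2E !quatE; ring. Qed.

Lemma dot_vfV_vfE2 (R : realType) (v w : 'rV[R]_4) :
  dot (vfV v) (vfE2 w) = dot v (vfE1 w).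
Proof. by rewrite !dotE4 vfVE vfE1E vfE2E !quatE; ring. Qed.

(** When a vector moves only by the infinitesimal rotation by i, its complex
    line does not move. *)
Lemma diff_offline (R : realType) (V : normedModType R) (W : V -> 'rV[R]_4)
    (w : 'rV[R]_4) (x a : V) (c : R) : differentiable W x ->
  'd W x a = c *: vfV (W x) ->
  differentiable (fun y => offline w (W y)) x /\
  'd (fun y => offline w (W y)) x a = 0.
Proof.
move=> dW dWa.
have dl v := differentiable_dot dW (differentiable_cst v x).
have dlE v : 'd (fun y => dot (W y) v) x a = c * dot (vfV (W x)) v.
  have -> : (fun y => dot (W y) v) = (fun y => dot v (W y)).
    by apply/funext => y; exact: dotC.
  by apply: etrans (diff_dot_cst v a dW) _; rewrite dotC dWa dotZl.
have E : (fun y => offline w (W y)) = (fun y => dot (W y) (vfE1 w)) ^+ 2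
    + (fun y => dot (W y) (vfE2 w)) ^+ 2 by [].
have dsq v : differentiable ((fun y => dot (W y) v) ^+ 2) x.
  exact/differentiableX/dl.
split; first by rewrite E; exact: differentiableD.
rewrite E -deriveE; last exact: differentiableD.
rewrite deriveD; [|exact: diff_derivable|exact: diff_derivable].
have DE v : 'D_a (fun y => dot (W y) v) x = c * dot (vfV (W x)) v.
  by apply: etrans (deriveE a (dl v)) (dlE v).
have DX v : 'D_a ((fun y => dot (W y) v) ^+ 2) x
    = 2 * (dot (W x) v * (c * dot (vfV (W x)) v)).
  rewrite deriveX; last exact: diff_derivable (dl v).
  by rewrite DE /GRing.scale /= expr1; ring.
rewrite !DX dot_vfV_vfE1 dot_vfV_vfE2; ring.
Qed.

(** The vectors w, iw, jw and kw are orthogonal of the same length, which gives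
    the identity of Parseval. *)
Lemma quaternion_parseval (R : realType) (w u v : 'rV[R]_4) :
  dot w w * dot u v = dot u w * dot v w + dot u (vfV w) * dot v (vfV w)
    + dot u (vfE1 w) * dot v (vfE1 w) + dot u (vfE2 w) * dot v (vfE2 w).
Proof. rewrite !dotE4 vfVE vfE1E vfE2E !quatE; ring. Qed.

Section Conservation.
Variables (R : realType) (M : topologicalType) (f N : M -> 'rV[R]_4) (h lam : R).
Hypothesis surff : C2_surface f.
Hypothesis normalN : unit_normal f N.
Hypothesis vertf : vertical f.
Hypothesis divN : forall m, is_divergence f N m h.
Hypothesis lamE : lam ^+ 2 = 1 + h * lam.
Hypothesis connM : connected [set: M].

Let f_S3 := surf_S3 surff.

(** For lam^2 = 1 + h lam, an eigenvector of the linear system satisfied by p and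
    N along the surface. *)
Definition axis_vector (m : M) : 'rV[R]_4 := f m + lam *: N m.
Local Notation W := axis_vector.

(** The Weingarten equations turn p + lam N by i, precisely because
    lam^2 = 1 + h lam. *)
Lemma diff_axis_vector U X u a : local_param f U X -> U u ->
  differentiable (W \o X) u /\ exists c, 'd (W \o X) u a = c *: vfV (W (X u)).
Proof.
move=> cX Uu.
have dF : differentiable (f \o X) u by exact: (chart_differentiable cX).
have dn : differentiable (N \o X) u.
  exact: (chart_normal_differentiable f_S3 normalN vertf cX).
have dln : differentiable (lam *: (N \o X)) u by exact: differentiableZ.
have WE : W \o X = (f \o X) + lam *: (N \o X) by [].
split; first by rewrite WE; exact: differentiableD.
have [x [y [dFa dna]]] : exists x y,
    'd (f \o X) u a = x *: vfV (f (X u)) + y *: vfV (N (X u)) /\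
    'd (N \o X) u a = x *: vfV (N (X u)) + y *: (vfV (f (X u)) + h *: vfV (N (X u))).
  have dFa := chart_tangent_expansion f_S3 normalN vertf cX a Uu.
  exists (dot ('d (f \o X) u a) (vfV (f (X u)))).
  exists (dot ('d (f \o X) u a) (vfV (N (X u)))).
  by split; [exact: dFa|exact (weingarten f_S3 normalN vertf cX divN Uu dFa)].
exists (x + lam * y).
have comb (p q p' q' : 'rV[R]_4) : p = p' -> q = q' -> p + lam *: q = p' + lam *: q'.
  by move=> -> ->.
have dWa : 'd (W \o X) u a = 'd (f \o X) u a + lam *: 'd (N \o X) u a.
  rewrite WE; apply: etrans (congr1 (@^~ a) (diffD dF dln)) _.
  by congr (_ + _); apply: etrans (congr1 (@^~ a) (diffZ lam dn)) _.
have alg (p q : 'rV[R]_4) :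
    x *: p + y *: q + lam *: (x *: q + y *: (p + h *: q))
    = (x + lam * y) *: (p + lam *: q).
  apply/rowP => i; rewrite !mxE; move: (p 0 i) (q 0 i) => r s.
  transitivity ((x + lam * y) * r + (lam * x + y * (1 + h * lam)) * s); first by ring.
  by rewrite -lamE; ring.
apply: etrans dWa (etrans (comb _ _ _ _ dFa dna) (etrans (alg _ _) _)).
by congr (_ *: _); rewrite /axis_vector (linearD (@vfV R)) linearZ.
Qed.

(** Being stationary in every chart, the distance of W to the line of w is
    constant on a connected surface, and it vanishes at m0. *)
Lemma offline_constant m0 m : offline (W m0) (W m) = 0.
Proof.
have -> : offline (W m0) (W m) = offline (W m0) (W m0); last exact: offline_self.
apply: (connected_locally_constant (g := fun p => offline (W m0) (W p))) => // p.
have [U [X [u [cX Uu <-]]]] := surf_param surff p.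
apply: (chart_near (P := [set q | offline (W m0) (W q) = offline (W m0) (W (X u))]) cX Uu).
apply: (diff0_locally_constant (g := fun v => offline (W m0) (W (X v)))).
apply: filterS (chart_nbhs cX Uu) => v Uv.
have diffW a : differentiable (W \o X) v /\ exists c, 'd (W \o X) v a = c *: vfV (W (X v)).
  exact (diff_axis_vector a cX Uv).
split; first by have [dW [c dWa]] := diffW 0; have [] := diff_offline (W m0) dW dWa.
by move=> a; have [dW [c dWa]] := diffW a; have [] := diff_offline (W m0) dW dWa.
Qed.

Lemma axis_vector_dot m : dot (W m) (W m) = 1 + lam ^+ 2.
Proof.
have ff := surface_dot f_S3 m; have nn := normal_dot normalN m.
have nf := normal_dot_surface normalN m.
by rewrite /W !dotE ff nn [dot (f m) _]dotC nf; ring.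
Qed.

Lemma axis_vector_surface m : dot (W m) (f m) = 1.
Proof.
have ff := surface_dot f_S3 m; have nf := normal_dot_surface normalN m.
by rewrite /W !dotE ff nf; ring.
Qed.

Lemma axis_vector_vertical m : dot (vfV (W m)) (f m) = 0.
Proof.
have nVf := normal_dot_vertical normalN vertf m.
by rewrite dot_vfVl /W !dotE dot_vfV_self nVf; ring.
Qed.

(** Since W stays in the complex line of w and keeps its length, its hermitian
    product with w has modulus |w|^2, and the products of W with p and i p
    determine the component of p in that line: it is W / |w|^2. *)
Lemma axis_vector_coordinates m0 m :
  let w := W m0 in
  [/\ dot (W m) w = (1 + lam ^+ 2) * dot (f m) w,
      dot (W m) (vfV w) = (1 + lam ^+ 2) * dot (f m) (vfV w) &
      dot (f m) w ^+ 2 + dot (f m) (vfV w) ^+ 2 = 1].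
Proof.
move=> w; have [w1 w2] := offline_eq0 (offline_constant m0 m).
have s0 : 1 + lam ^+ 2 != 0 by rewrite gt_eqF // ltr_wpDr ?sqr_ge0.
have e1 := quaternion_parseval w (W m) (f m).
have e2 := quaternion_parseval w (vfV (W m)) (f m).
have e3 := quaternion_parseval w (W m) (W m).
move: e1 e2 e3; rewrite !dot_vfV_vfE1 !dot_vfV_vfE2 -/w w1 w2 dot_vfV.
rewrite !axis_vector_dot axis_vector_surface axis_vector_vertical.
rewrite [dot (vfV (W m)) w]dot_vfVl.
move: (dot (W m) w) (dot (W m) (vfV w)) (dot (f m) w) (dot (f m) (vfV w)).
move: (1 + lam ^+ 2) s0 => s s0 A B P Q e1 e2 e3.
have PQ : P ^+ 2 + Q ^+ 2 = 1.
  apply: (mulfI (mulf_neq0 s0 s0)).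
  have -> : s * s * (P ^+ 2 + Q ^+ 2) = (A * P + B * Q) ^+ 2 + (A * Q - B * P) ^+ 2.
    by rewrite e3; ring.
  have -> : A * P + B * Q = s by rewrite -[RHS]mulr1 e1; ring.
  have -> : A * Q - B * P = 0 by rewrite -(mulr0 s) e2; ring.
  by ring.
split => //.
- transitivity (A * (P ^+ 2 + Q ^+ 2)); first by rewrite PQ mulr1.
  have -> : s = A * P + B * Q by rewrite -[LHS]mulr1 e1; ring.
  have BP : B * P = A * Q.
    by apply/eqP; rewrite -subr_eq0 -oppr_eq0 -(mulr0 s) e2; apply/eqP; ring.
  by transitivity (A * P ^+ 2 + (A * Q) * Q); [ring|rewrite -BP; ring].
- transitivity (B * (P ^+ 2 + Q ^+ 2)); first by rewrite PQ mulr1.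
  have -> : s = A * P + B * Q by rewrite -[LHS]mulr1 e1; ring.
  have BP : B * P = A * Q.
    by apply/eqP; rewrite -subr_eq0 -oppr_eq0 -(mulr0 s) e2; apply/eqP; ring.
  by transitivity ((B * P) * P + B * Q ^+ 2); [ring|rewrite BP; ring].
Qed.
End Conservation.

(** * Local lifts of curves *)


Lemma norm_sqr_le_dot (R : realType) n (v : 'rV[R]_n) : `|v| ^+ 2 <= dot v v.
Proof.
have le_sqrt : `|v| <= Num.sqrt (dot v v).
  apply: norm_le_coord => [|i]; first exact: sqrtr_ge0.
  rewrite -sqrtr_sqr ler_wsqrtr // /dot (bigD1 i) //= -expr2 lerDl.
  by apply: sumr_ge0 => j _; rewrite -expr2 sqr_ge0.
rewrite -[leRHS]sqr_sqrtr ?dot_ge0 //.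
by rewrite ler_sqr ?nnegrE ?sqrtr_ge0.
Qed.

Lemma dot_le_norm_sqr (R : realType) n (v : 'rV[R]_n) :
  dot v v <= n%:R * `|v| ^+ 2.
Proof.
rewrite /dot; have -> : n%:R * `|v| ^+ 2 = \sum_(i < n) `|v| ^+ 2.
  by rewrite sumr_const card_ord mulr_natl.
apply: ler_sum => i _; rewrite -expr2 -real_normK ?num_real //.
by rewrite ler_sqr ?nnegrE // coord_le_norm.
Qed.

Lemma closed_ball_compact (R : realType) n (u : 'rV[R]_n) (r : R) : 0 < r ->
  compact (closed_ball u r).
Proof.
move=> r0; apply: bounded_closed_compact; last exact: closed_ball_closed.
rewrite closed_ballE //; exists (`|u| + r); split; first exact: num_real.
move=> x xr y /= uy; rewrite (le_trans _ (ltW xr)) //.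
have -> : y = u - (u - y) by rewrite opprB addrC subrK.
by rewrite (le_trans (ler_normB _ _)) // lerD2l.
Qed.

(** Gathers around a parameter all that is needed to argue in one small disc. *)
Lemma chart_local_frame (R : realType) (M : topologicalType)
    (f : M -> 'rV[R]_4) U X u (P : set 'rV[R]_2) : local_param f U X -> U u ->
  nbhs u P -> exists r c : R, [/\ 0 < r, 0 < c, ball u r `<=` U `&` P &
    forall x y, ball u r x -> ball u r y ->
      c * `|x - y| <= `|f (X x) - f (X y)|].
Proof.
move=> cX Uu nP.
have nU := chart_nbhs cX Uu.
have dF : \forall y \near u, differentiable (f \o X) y.
  by apply: filterS nU => y Uy; exact: (chart_differentiable cX Uy).
have cdF v : {for u, continuous ('D_v (f \o X))}.
  exact: differentiable_continuous (chart_D_differentiable cX v Uu).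
have [c c0 hc] := immersion_lower_bound dF cdF (lp_immersion cX Uu).
have [r0 /= r00 hr0] := (nbhs_ballP _ _).1 (filterI nU nP).
have [r [rc r_gt0 rr0]] : exists r, [/\ forall x y, ball u r x -> ball u r y ->
    c * `|x - y| <= `|f (X x) - f (X y)|, 0 < r & r <= r0].
  have : \forall r \near (0 : R)^'+, (forall x y, ball u r x -> ball u r y ->
      c * `|x - y| <= `|f (X x) - f (X y)|) /\ 0 < r /\ r <= r0.
    near=> r; split; first by near: r; exact: hc.
    by split; near: r; [exact: nbhs_right_gt|exact: nbhs_right_le].
  move=> /filter_ex[r [h1 [h2 h3]]]; by exists r.
exists r, c; split => // x /(le_ball rr0) /hr0; exact.
Unshelve. all: by end_near. Qed.

Lemma continuous_clamp (R : realType) (a b : R) :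
  continuous (fun t : R => Num.max a (Num.min b t)).
Proof.
move=> t; apply: continuous_max; first exact: cst_continuous.
by apply: continuous_min; [exact: cst_continuous|exact: cvg_id].
Qed.

Lemma clamp_mem (R : realType) (a b t : R) : a <= b ->
  a <= Num.max a (Num.min b t) <= b.
Proof. by move=> ab; rewrite le_max lexx ge_max ab ge_min lexx. Qed.

Lemma clamp_id (R : realType) (a b t : R) : a <= t <= b ->
  Num.max a (Num.min b t) = t.
Proof. by move=> /andP[at_ tb]; rewrite (min_idPr tb) (max_idPr at_). Qed.

Section LocalInverse.
Variables (R : realType) (M : topologicalType) (f : M -> 'rV[R]_4).
Variables (T : set 'rV[R]_4) (eps : R).
Hypothesis eps0 : 0 < eps.
Hypothesis surff : C2_surface f.

(** On a surface contained in T this expresses that the tangent planes of the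
    surface are those of T: the point of the surface closest to a given point y
    of T sees y orthogonally, hence is y. *)
Hypothesis orthogonal_eq : forall U X u y, local_param f U X -> U u -> T y ->
  `|y - f (X u)| < eps ->
  (forall a, dot (y - f (X u)) ('d (f \o X) u a) = 0) -> y = f (X u).

(** The distance to y has a minimum on a small closed disc; the lower bound for
    the immersion keeps the minimum away from the boundary, so it is a critical
    point and the hypothesis on T applies. *)
Lemma local_surjective U X u (r c : R) : local_param f U X -> U u -> 0 < r ->
  0 < c -> ball u r `<=` U ->
  (forall x y, ball u r x -> ball u r y -> c * `|x - y| <= `|f (X x) - f (X y)|) ->
  exists2 d, 0 < d & forall y, T y -> `|y - f (X u)| < d ->
    exists2 v, ball u r v & f (X v) = y.
Proof.
move=> cX Uu r0 c0 BU lowF.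
pose d := Num.min (eps / 4) (c * r / 8).
have d0 : 0 < d by rewrite lt_min !divr_gt0 // mulr_gt0.
exists d => // y Ty yu.
pose K := closed_ball u (r / 2).
have r20 : 0 < r / 2 by rewrite divr_gt0.
have KB v : K v -> ball u r v.
  rewrite /K closed_ballE // -ball_normE /closed_ball_ /= => /le_lt_trans; apply.
  by rewrite ltr_pdivrMr // mulr_natr mulr2n ltrDl.
pose G v := (f \o X) v - y.
pose phi v := dot (G v) (G v).
have dG v : U v -> is_diff v G ('d (f \o X) v).
  move=> Uv; have dF := chart_differentiable cX Uv.
  have dy := @differentiable_cst _ _ _ y v.
  split; first exact: differentiableB.
  apply: etrans (diffB dF dy) _; apply/funext => a.
  have dy0 : 'd (cst y) v a = 0 by rewrite diff_cst.
  exact: etrans (congr1 (fun z => 'd (f \o X) v a - z) dy0) (subr0 _).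
have dphi v : U v -> differentiable phi v.
  by move=> Uv; have [dGv _] := dG v Uv; exact: differentiable_dot.
have Ku : K u by exact: closed_ballxx.
have [w /set_mem Kw wmin] : exists2 w, w \in K & forall t, t \in K -> phi w <= phi t.
  apply: EVT_min_rV; first by exists u.
    exact: closed_ball_compact.
  apply: continuous_in_subspaceT => v /set_mem Kv.
  exact: differentiable_continuous (dphi v (BU _ (KB _ Kv))).
have Uw := BU _ (KB _ Kw).
have Gu : `|G u| < d by rewrite distrC.
have Gw : `|G w| <= 2 * d.
  have := wmin u (mem_set Ku).
  have := norm_sqr_le_dot (G w); have := dot_le_norm_sqr (G u) => h1 h2 h3.
  have h4 : `|G u| ^+ 2 <= d ^+ 2 by rewrite ler_sqr ?nnegrE // ltW.
  have : `|G w| ^+ 2 <= (2 * d) ^+ 2.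
    apply: le_trans h2 (le_trans h3 (le_trans h1 _)).
    by rewrite exprMn -natrX ler_wpM2l.
  by rewrite ler_sqr // nnegrE // mulr_ge0 // ltW.
have Bw : ball u (r / 2) w.
  rewrite -ball_normE /= -(ltr_pM2l c0).
  have h1 := lowF _ _ (ballxx u r0) (KB _ Kw).
  have h2 : `|f (X u) - f (X w)| <= `|G u| + `|G w|.
    have -> : f (X u) - f (X w) = G u - G w by rewrite /G /= opprB addrA subrK.
    exact: ler_normB.
  have h3 : d <= c * r / 8 by rewrite ge_min lexx orbT.
  have h4 : 0 < c * r by rewrite mulr_gt0.
  rewrite mulrA; lra.
have crit a : dot (y - f (X w)) ('d (f \o X) w a) = 0.
  have [dGw dGE] := dG w Uw.
  have phi_min : \forall t \near w, phi w <= phi t.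
    have : nbhs w (ball u (r / 2)).
      by apply: open_nbhs_nbhs; split; [exact: ball_open|exact: Bw].
    apply: filterS => t ut; apply: wmin; apply: mem_set.
    exact: subset_closed_ball.
  have dphi_near : \forall t \near w, differentiable phi t.
    by apply: filterS (chart_nbhs cX Uw) => t; exact: dphi.
  have comb (p q q' : 'rV[R]_4) : dot q p + dot p q = 0 -> q = q' -> dot (- p) q' = 0.
    move=> /orthogonal_of_unit pq <-; by rewrite dotNl dotC pq oppr0.
  rewrite -opprB; apply: comb (congr1 (@^~ a) dGE).
  exact: etrans (esym (diff_dot a dGw dGw)) (diff_eq0_at_min a dphi_near phi_min).
exists w; first exact: KB.
apply: esym; apply: (orthogonal_eq cX Uw Ty) => //.
rewrite distrC (le_lt_trans Gw) //.
have : d <= eps / 4 by rewrite ge_min lexx.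
lra.
Qed.

(** In a small disc the immersion is injective with a Lipschitz inverse, so the
    points above the curve are unique and form a continuous curve [g]. *)
Lemma local_lift (gam : R -> 'rV[R]_4) t0 m0 : continuous gam ->
  (forall t, T (gam t)) -> f m0 = gam t0 ->
  exists eta : R, exists O : set M, exists g : R -> M,
  [/\ 0 < eta, nbhs m0 O, continuous g,
    forall t, `|t - t0| <= eta -> f (g t) = gam t &
    forall m s, O m -> `|s - t0| <= eta -> f m = gam s -> g s = m].
Proof.
move=> cgam Tgam fm0.
have [U [X [u [cX Uu Xu]]]] := surf_param surff m0.
have [r [c [r0 c0 BU lowF]]] := chart_local_frame cX Uu filterT.
have {}BU : ball u r `<=` U by move=> x /BU[].
have [d d0 hd] := local_surjective cX Uu r0 c0 BU lowF.
have /cvgrPdist_lt/(_ _ d0) near_t0 := cgam t0.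
have [e /= e0 he] := (nbhs_ballP _ _).1 near_t0.
pose eta := e / 2; have eta0 : 0 < eta by rewrite divr_gt0.
pose kap t := Num.max (t0 - eta) (Num.min (t0 + eta) t).
have kapP t : t0 - eta <= kap t <= t0 + eta by apply: clamp_mem; lra.
have kapE t : `|t - t0| <= eta -> kap t = t.
  by rewrite ler_norml => tt0; apply: clamp_id; lra.
have sol t : exists v, ball u r v /\ f (X v) = gam (kap t).
  have [|v Bv fv] := hd _ (Tgam (kap t)); last by exists v.
  rewrite Xu fm0 distrC; apply: he; rewrite -ball_normE /= ltr_norml.
  by have := kapP t; rewrite /eta; lra.
have [sig sigP] := choice sol.
have sigB t : ball u r (sig t) by case: (sigP t).
have sigE t : f (X (sig t)) = gam (kap t) by case: (sigP t).
have csig : continuous sig.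
  move=> t; apply/cvgrPdist_lt => e' e'0.
  have cgk : {for t, continuous (gam \o kap)}.
    by apply: continuous_comp; [exact: continuous_clamp|exact: cgam].
  have ce0 : 0 < c * e' by rewrite mulr_gt0.
  move/cvgrPdist_lt : cgk => /(_ _ ce0); apply: filterS => t' tt'.
  rewrite -(ltr_pM2l c0); apply: le_lt_trans (lowF _ _ (sigB _) (sigB _)) _.
  by rewrite !sigE.
exists eta, (X @` ball u r), (X \o sig); split => //.
- rewrite -Xu; apply: (chart_near cX Uu).
  have : nbhs u (ball u r) by exact: nbhsx_ballx.
  by apply: filterS => v uv; exists v.
- move=> t; apply: continuous_comp; first exact: csig.
  exact: lp_continuous cX _ (BU _ (sigB t)).
- by move=> t tt0; rewrite /= sigE kapE.
- move=> _ s [v Bv <-] st0 fXv; congr X; apply/eqP.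
  rewrite -subr_eq0 -normr_eq0 eq_le normr_ge0 andbT.
  rewrite -(pmulr_rle0 _ c0); apply: le_trans (lowF _ _ (sigB _) Bv) _.
  by rewrite sigE kapE // fXv subrr normr0.
Qed.
End LocalInverse.

(** * Intrinsic distance *)


Lemma continuous_enorm (R : realType) (T : topologicalType) n
    (F : T -> 'rV[R]_n) : continuous F -> continuous (fun x => enorm (F x)).
Proof.
move=> cF x; apply: (continuous_comp (f := fun y => dot (F y) (F y))).
  by apply: continuous_dot; exact: cF.
exact: sqrt_continuous.
Qed.

Lemma coord_le_enorm (R : realType) n (v : 'rV[R]_n) i : `|v 0 i| <= enorm v.
Proof.
apply: le_trans (coord_le_norm v i) _; rewrite /enorm.
rewrite -[leLHS]ger0_norm // -sqrtr_sqr ler_wsqrtr //.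
exact: norm_sqr_le_dot.
Qed.

(** The fundamental theorem of calculus for each coordinate. *)
Lemma curve_length_ge (R : realType) (M : topologicalType) (f : M -> 'rV[R]_4)
    (g : R -> M) (t : R) : C1_curve f g -> t \in `[0, 1] ->
  (`|f (g t) - f (g 1)|%:E <= curve_length f g)%E.
Proof.
move=> [_ dg cdg]; rewrite in_itv /= => /andP[t0 t1].
have L0 : (0 <= curve_length f g)%E.
  by apply: integral_ge0 => x _; rewrite lee_fin /enorm sqrtr_ge0.
have coordL i : (`|(f (g t) - f (g 1)) 0 i|%:E <= curve_length f g)%E.
  have [<-|t_neq1] := eqVneq t 1; first by rewrite subrr mxE normr0.
  have t_lt1 : t < 1 by rewrite lt_neqAle t_neq1.
  pose hi (x : R) : R := (f \o g) x 0 i.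
  pose dhi (x : R) : R := derive1 (f \o g) x 0 i.
  have chi : continuous dhi.
    by move=> x; apply: (continuous_comp (g := fun v : 'rV[R]_4 => v 0 i));
      [exact: cdg|exact: coord_continuous].
  have dhiE (x : R) : is_derive x (1 : R) hi (dhi x).
    split; first exact: (derivable_mxP _ _ _).1 (dg x) _ _.
    by rewrite /dhi derive1E (derive_mx (dg x)) mxE.
  have ftc : (\int[lebesgue_measure]_(x in `[t, 1%R]) (dhi x)%:E = (hi 1)%:E - (hi t)%:E)%E.
    apply: continuous_FTC2 => //.
    - exact: continuous_subspaceT.
    - have chi' x : {for x, continuous hi}.
        by apply/differentiable_continuous/derivable1_diffP; case: (dhiE x).
      split.
      + by move=> x _; case: (dhiE x).
      + exact: cvg_at_right_filter (chi' t).
      + exact: cvg_at_left_filter (chi' 1).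
    - by move=> x _; rewrite derive1E; case: (dhiE x).
  have -> : (f (g t) - f (g 1)) 0 i = hi t - hi 1 by rewrite !mxE.
  have -> : `|hi t - hi 1|%:E =
      `|\int[lebesgue_measure]_(x in `[t, 1%R]) (dhi x)%:E|%E.
    by rewrite ftc distrC.
  apply: le_trans (le_abse_integral _ _ _) _ => //.
    apply/measurable_EFinP; apply: measurable_funTS.
    exact: continuous_measurable_fun.
  have le_dhi x : (`|(dhi x)%:E| <= (enorm (derive1 (f \o g) x))%:E)%E.
    by rewrite lee_fin; exact: coord_le_enorm.
  apply: (@le_trans _ _
     (\int[lebesgue_measure]_(x in `[t, 1%R]) (enorm (derive1 (f \o g) x))%:E)%E).
    apply: ge0_le_integral => //.
    - apply/measurable_EFinP/measurable_funTS; apply: continuous_measurable_fun.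
      by move=> x; apply: cvg_norm; exact: chi.
    - apply/measurable_EFinP/measurable_funTS; apply: continuous_measurable_fun.
      exact: continuous_enorm.
  apply: ge0_subset_integral => //.
  - apply/measurable_EFinP/measurable_funTS; apply: continuous_measurable_fun.
    exact: continuous_enorm.
  - by move=> x _; rewrite lee_fin sqrtr_ge0.
  - by move=> x /=; rewrite !in_itv /= => /andP[tx ->]; rewrite (le_trans t0 tx).
move: L0 coordL; case: (curve_length f g) => [l||] // L0 coordL.
  rewrite lee_fin; apply: norm_le_coord; first by rewrite -lee_fin.
  by move=> i; rewrite -lee_fin.
by rewrite leey.
Qed.

Lemma preimage_closed (S T : topologicalType) (g : S -> T) (A : set T) :
  continuous g -> closed A -> closed (g @^-1` A).
Proof.
move=> cg cA; rewrite -openC preimage_setC.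
by apply: open_comp => [x _|]; [exact: cg|rewrite openC].
Qed.

Lemma surf_dist_ge (R : realType) (M : topologicalType) (f : M -> 'rV[R]_4) m p :
  (`|f m - f p|%:E <= surf_dist f m p)%E.
Proof.
apply: le_ereal_inf_tmp => _ [g [cg g0 g1] <-].
have o01 : (0 : R) \in `[0, 1] by rewrite in_itv /= lexx ler01.
by rewrite -g0 -g1; exact: curve_length_ge cg o01.
Qed.

(** A curve too short to cross the boundary of a small coordinate disc stays
    inside the disc. *)
Lemma small_dist_nbhd (R : realType) (M : topologicalType) (f : M -> 'rV[R]_4)
    (p : M) (O : set M) : C2_surface f -> nbhs p O ->
  exists2 e : R, 0 < e & forall m, (surf_dist f m p < e%:E)%E -> O m.
Proof.
move=> surff nO.
have [U [X [u [cX Uu Xu]]]] := surf_param surff p.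
have nP : nbhs u [set v | O (X v)].
  have nO' : nbhs (X u) O by rewrite Xu.
  exact: (lp_continuous cX Uu nO').
have [r [c [r0 c0 BUO lowF]]] := chart_local_frame cX Uu nP.
have r20 : 0 < r / 2 by rewrite divr_gt0.
pose B := ball u (r / 2); pose K := closed_ball u (r / 2).
have KB v : K v -> ball u r v.
  rewrite /K closed_ballE // -ball_normE /closed_ball_ /= => /le_lt_trans; apply.
  by rewrite ltr_pdivrMr // mulr_natr mulr2n ltrDl.
have BK v : B v -> K v by exact: subset_closed_ball.
exists (c * (r / 2)); first by rewrite mulr_gt0.
move=> m /ereal_inf_lt[_ [g [cg g0 g1] <-] len_g].
have inside t : t \in `[0, 1] -> (X @` K) (g t) -> (X @` B) (g t).
  move=> t01 [v Kv Xv]; exists v => //.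
  have := le_lt_trans (curve_length_ge cg t01) len_g.
  rewrite lte_fin g1 -Xv -Xu => short.
  rewrite /B -ball_normE /= distrC -(ltr_pM2l c0).
  exact: le_lt_trans (lowF _ _ (KB _ Kv) (ballxx u r0)) short.
have oB : open (X @` B).
  by apply: (lp_open_map cX); [exact: ball_open|move=> v /BK/KB/BUO[]].
have cK : closed (X @` K).
  apply: compact_closed; first exact: surf_hausdorff surff.
  apply: continuous_compact; last exact: closed_ball_compact.
  apply: continuous_in_subspaceT => v /set_mem /KB /BUO[Uv _].
  exact: lp_continuous cX _ Uv.
have cont_g := curve_continuous cg.
have : `[0, 1]%classic `&` g @^-1` (X @` B) = `[0, 1]%classic.
  apply: (@segment_connected R 0 1).
  - exists (1 : R); split; first by rewrite /= in_itv /= lexx ler01.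
    by rewrite /= g1; exists u => //; exact: ballxx.
  - exists (g @^-1` (X @` B)) => //.
    by apply: open_comp => // x _; exact: cont_g.
  - exists (g @^-1` (X @` K)); first exact: preimage_closed.
    apply/seteqP; split => t [t01 gt]; split => //.
      by have [v Bv Xv] := gt; exists v => //; exact: BK.
    exact: inside.
move=> /seteqP[_ /(_ 0)] [|_ [v Bv Xv]].
  by rewrite /= in_itv /= lexx ler01.
by rewrite -g0 -Xv; have [] := BUO _ (KB _ (BK _ Bv)).
Qed.

Lemma enormZ (R : realType) n (c : R) (v : 'rV[R]_n) : enorm (c *: v) = `|c| * enorm v.
Proof. by rewrite /enorm !dotE mulrA -expr2 sqrtrM ?sqr_ge0 // sqrtr_sqr. Qed.

Lemma is_derive_curve_comp (R : realType) (V : normedModType R) (gam : R -> V)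
    (phi : R -> R) (x : R) (dg : V) (dphi : R) :
  is_derive x (1 : R) phi dphi -> is_derive (phi x) (1 : R) gam dg ->
  is_derive x (1 : R) (gam \o phi) (dphi *: dg).
Proof.
move=> [phix dphiE] [gamx dgamE].
have dp := (derivable1_diffP _ _).1 phix.
have dg' := (derivable1_diffP _ _).1 gamx.
have dc : differentiable (gam \o phi) x by exact: differentiable_comp.
split; first exact/derivable1_diffP.
apply: etrans (deriveE _ dc) _.
apply: etrans (congr1 (@^~ 1) (diff_comp dp dg')) _ => /=.
have -> : 'd phi x 1 = dphi by rewrite -dphiE; apply: esym; exact: deriveE.
rewrite -[X in 'd gam _ X]mulr1 -[X in 'd gam _ X]/(dphi *: (1 : R)) linearZ.
by congr (_ *: _); rewrite -dgamE; apply: esym; exact: deriveE.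
Qed.

(** A lift of an arc is traversed at the speed of a cosine, so that the curve is
    defined and continuously differentiable on the whole line. *)
Lemma lift_dist (R : realType) (M : topologicalType) (f : M -> 'rV[R]_4)
    (gam dgam : R -> 'rV[R]_4) (L : R) (g : R -> M) (a b s t : R) :
  (forall x : R, is_derive x (1 : R) gam (dgam x)) -> continuous dgam ->
  (forall x, enorm (dgam x) <= L) -> continuous g ->
  (forall x, a <= x <= b -> f (g x) = gam x) -> a <= s <= b -> a <= t <= b ->
  (surf_dist f (g s) (g t) <= (L * pi * `|t - s|)%:E)%E.
Proof.
move=> dg cdg gL cg fg sab tab.
(* Goes from s at time 0 to t at time 1 and stays between them at all times. *)
pose phi x : R := (s + t) / 2 - (t - s) / 2 * cos (pi * x).
pose dphi x : R := (t - s) / 2 * (sin (pi * x) * pi).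
have phi_ab x : a <= phi x <= b.
  have := cos_geN1 (pi * x); have := cos_le1 (pi * x).
  rewrite /phi; move: (cos _) sab tab => k /andP[as_ sb] /andP[at_ tb] k1 k2.
  have -> : (s + t) / 2 - (t - s) / 2 * k = (1 + k) / 2 * s + (1 - k) / 2 * t by field.
  have k3 : 0 <= (1 + k) / 2 by lra.
  have k4 : 0 <= (1 - k) / 2 by lra.
  have := ler_wpM2l k3 as_; have := ler_wpM2l k3 sb.
  have := ler_wpM2l k4 at_; have := ler_wpM2l k4 tb.
  lra.
have phi0 : phi 0 = s by rewrite /phi mulr0 cos0; field.
have phi1 : phi 1 = t by rewrite /phi mulr1 cospi; field.
have dphiE (x : R) : is_derive x (1 : R) phi (dphi x).
  have -> : phi = cst ((s + t) / 2) - ((t - s) / 2) *: (cos \o ( *%R pi)) by [].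
  have dpi : is_derive x (1 : R) ( *%R pi) pi.
    have -> : *%R pi = pi *: (id : R -> R) by [].
    by apply: is_derive_eq; rewrite /GRing.scale /= mulr1.
  have dcos := is_derive1_comp (f := cos) (is_derive_cos (pi * x)) dpi.
  apply: is_derive_eq; rewrite /dphi /GRing.scale /=; ring.
have cdphi : continuous dphi.
  move=> x; apply: cvgM; first exact: cvg_cst.
  apply: cvgM; last exact: cvg_cst.
  apply: (continuous_comp (f := fun y => pi * y) (g := sin)).
    by apply: cvgM; [exact: cvg_cst|exact: cvg_id].
  exact: continuous_sin.
have cphi : continuous phi.
  by move=> x; apply/differentiable_continuous/derivable1_diffP; case: (dphiE x).
have fgphi : f \o (g \o phi) = gam \o phi.
  by apply/funext => x; exact: fg (phi_ab x).
have dcomp (x : R) : is_derive x (1 : R) (f \o (g \o phi)) (dphi x *: dgam (phi x)).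
  by rewrite fgphi; exact: is_derive_curve_comp.
have dcompE : derive1 (f \o (g \o phi)) = fun x => dphi x *: dgam (phi x).
  by apply/funext => x; rewrite derive1E; case: (dcomp x).
apply: (@le_trans _ _ (curve_length f (g \o phi))).
  apply: ereal_inf_lbound; exists (g \o phi) => //.
  split; [|by rewrite /= phi0|by rewrite /= phi1].
  split.
  - by move=> x; apply: continuous_comp; [exact: cphi|exact: cg].
  - by move=> x; case: (dcomp x).
  - rewrite dcompE => x; apply: cvgZ; first exact: cdphi.
    by apply: continuous_comp; [exact: cphi|exact: cdg].
have L0 : 0 <= L by apply: le_trans (gL 0); rewrite sqrtr_ge0.
have speed x : enorm (derive1 (f \o (g \o phi)) x) <= L * pi * `|t - s|.
  rewrite dcompE enormZ; apply: (@le_trans _ _ (`|dphi x| * L)).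
    by rewrite ler_wpM2l.
  rewrite /dphi !normrM mulrC -!mulrA ler_wpM2l //.
  have pi0 := pi_gt0 R; rewrite (gtr0_norm pi0).
  have -> : `|2^-1| = 2^-1 :> R by rewrite ger0_norm.
  have sin1 := sin_max (pi * x).
  have h1 : 0 <= `|t - s| * pi by rewrite mulr_ge0 // ltW.
  have := ler_wpM2l h1 sin1.
  have := mulr_ge0 h1 (normr_ge0 (sin (pi * x))); lra.
apply: (@le_trans _ _
   (\int[lebesgue_measure]_(x in `[0%R, 1%R]) (cst (L * pi * `|t - s|)%:E x))%E).
  apply: ge0_le_integral => //.
  - by move=> x _; rewrite lee_fin sqrtr_ge0.
  - apply/measurable_EFinP/measurable_funTS; apply: continuous_measurable_fun.
    apply: continuous_enorm; rewrite dcompE => x; apply: cvgZ; first exact: cdphi.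
    by apply: continuous_comp; [exact: cphi|exact: cdg].
  - by move=> x _; rewrite lee_fin; exact: speed.
rewrite integral_cst //= lebesgue_measure_itv /= lte_fin ltr01 -EFinB subr0.
by rewrite mule1.
Qed.

(** * Lifting curves to a complete surface *)


Lemma continuous_glue (R : realType) (M : topologicalType) (g1 g2 : R -> M)
    (b : R) : continuous g1 -> continuous g2 -> g1 b = g2 b ->
  continuous (fun t => if t <= b then g1 t else g2 t).
Proof.
move=> c1 c2 g12 t O /=; rewrite /nbhs /= => nO.
have [tb|bt|tb] := ltgtP t b.
- have n1 : nbhs t (g1 @^-1` O) by apply: c1; move: nO; rewrite /= (ltW tb).
  have n2 : \forall s \near t, s < b by exact: lt_nbhsl.
  by apply: filterS2 n1 n2 => s Os sb; rewrite /= (ltW sb).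
- have n1 : nbhs t (g2 @^-1` O) by apply: c2; move: nO; rewrite /= leNgt bt.
  have n2 : \forall s \near t, b < s by exact: lt_nbhsr.
  by apply: filterS2 n1 n2 => s Os sb; rewrite /= leNgt sb.
- have n1 : nbhs t (g1 @^-1` O) by apply: c1; move: nO; rewrite /= tb lexx.
  have n2 : nbhs t (g2 @^-1` O).
    by apply: c2; move: nO; rewrite /= tb lexx g12.
  by apply: filterS2 n1 n2 => s O1 O2 /=; case: ifP.
Qed.

Section PathLifting.
Variables (R : realType) (M : topologicalType) (f : M -> 'rV[R]_4).
Variables (T : set 'rV[R]_4) (eps L : R) (gam dgam : R -> 'rV[R]_4) (m0 : M).
Hypothesis eps0 : 0 < eps.
Hypothesis surff : C2_surface f.
Hypothesis completef : complete_surface f.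
Hypothesis orthogonal_eq : forall U X u y, local_param f U X -> U u -> T y ->
  `|y - f (X u)| < eps ->
  (forall a, dot (y - f (X u)) ('d (f \o X) u a) = 0) -> y = f (X u).
Hypothesis dgamE : forall x : R, is_derive x (1 : R) gam (dgam x).
Hypothesis dgam_continuous : continuous dgam.
Hypothesis dgam_bounded : forall x, enorm (dgam x) <= L.
Hypothesis gamT : forall t, T (gam t).
Hypothesis fm0 : f m0 = gam 0.

Let gam_continuous : continuous gam.
Proof.
by move=> x; apply/differentiable_continuous/derivable1_diffP; case: (dgamE x).
Qed.

(** A pair is a time and a point of the surface above the curve at that time; the
    relation says that a lift of the curve leads from the first to the second. *)
Definition lifts (x y : R * M) := x.1 <= y.1 /\ exists g : R -> M,
  [/\ continuous g, g x.1 = x.2, g y.1 = y.2 &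
    forall t, x.1 <= t <= y.1 -> f (g t) = gam t].

Lemma lifts_refl x : f x.2 = gam x.1 -> lifts x x.
Proof.
move=> fx; split => //; exists (cst x.2); split => //; first exact: cst_continuous.
by move=> t /le_anti <-.
Qed.

Lemma lifts_trans x y z : lifts x y -> lifts y z -> lifts x z.
Proof.
move=> [xy [g1 [c1 g1x g1y lift1]]] [yz [g2 [c2 g2y g2z lift2]]].
split; first exact: le_trans yz.
exists (fun t => if t <= y.1 then g1 t else g2 t); split.
- by apply: continuous_glue => //; rewrite g1y g2y.
- by rewrite xy.
- by case: ifP => // zy; rewrite -g2z; have -> : z.1 = y.1 by [apply: le_anti; rewrite zy]; rewrite g2y.
- move=> t /andP[xt tz]; case: ifP => [ty|/negbT]; first by rewrite lift1 // xt.
  by rewrite -ltNge => /ltW yt; rewrite lift2 // yt.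
Qed.

Lemma lifts_position x y : lifts x y -> f y.2 = gam y.1.
Proof.
by move=> [xy [g [_ _ <- lift]]]; rewrite lift // xy lexx.
Qed.

Lemma lifts_dist x y : lifts x y ->
  (surf_dist f x.2 y.2 <= (L * pi * `|y.1 - x.1|)%:E)%E /\
  (surf_dist f y.2 x.2 <= (L * pi * `|y.1 - x.1|)%:E)%E.
Proof.
move=> [xy [g [cg <- <- lift]]].
have x_in : x.1 <= x.1 <= y.1 by rewrite lexx.
have y_in : x.1 <= y.1 <= y.1 by rewrite lexx andbT.
split; first exact: lift_dist dgamE dgam_continuous dgam_bounded cg lift x_in y_in.
by rewrite distrC; exact: lift_dist dgamE dgam_continuous dgam_bounded cg lift y_in x_in.
Qed.

(** The supremum of the attainable times need not be attained, but times beyond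
    the midpoint are. *)
Lemma lifts_greedy x : f x.2 = gam x.1 -> x.1 <= 1 ->
  exists y, [/\ lifts x y, y.1 <= 1 &
    forall z, lifts x z -> z.1 <= 1 -> z.1 - x.1 <= 2 * (y.1 - x.1)].
Proof.
move=> fx x1.
pose S := [set t : R | exists2 z, lifts x z & z.1 <= 1 /\ z.1 = t].
have Sx : S x.1 by exists x; [exact: lifts_refl|].
have ubS : ubound S 1 by move=> _ [z _ [z1 <-]].
have supS : has_sup S by split; [exists x.1|exists 1].
have le_sup z : lifts x z -> z.1 <= 1 -> z.1 <= sup S.
  by move=> xz z1; apply: sup_upper_bound => //; exists z.
have [supx|xsup] := leP (sup S) x.1.
  exists x; split => //; first exact: lifts_refl.
  by move=> z xz z1; rewrite subrr mulr0 subr_le0 (le_trans (le_sup _ xz z1)).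
have e0 : 0 < (sup S - x.1) / 2 by lra.
have [_ [y xy [y1 <-]] supy] := sup_adherent e0 supS.
exists y; split => // z xz z1; have := le_sup _ xz z1; lra.
Qed.

(** The greedy lifts define a Cauchy sequence, whose limit p lies above the curve
    at the limit time l. If l < 1, the local lift through p extends late greedy
    lifts beyond l by a fixed amount, against the choice of their steps. *)
Lemma path_lifting : exists m, f m = gam 1.
Proof.
have step (x : R * M) : exists y, f x.2 = gam x.1 -> x.1 <= 1 ->
    [/\ lifts x y, y.1 <= 1 &
      forall z, lifts x z -> z.1 <= 1 -> z.1 - x.1 <= 2 * (y.1 - x.1)].
  have [[fx x1]|nx] := pselect (f x.2 = gam x.1 /\ x.1 <= 1).
    by have [y yP] := lifts_greedy fx x1; exists y.
  by exists x => fx x1; case: nx.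
have [next nextP] := choice step.
pose s k := iter k next (0, m0).
have sP k : f (s k).2 = gam (s k).1 /\ (s k).1 <= 1.
  elim: k => [|k [fk k1]]; first by rewrite /= ler01.
  by have [/lifts_position] := nextP _ fk k1.
have s_step k := nextP (s k) (sP k).1 (sP k).2.
have s_lifts i j : (i <= j)%N -> lifts (s i) (s j).
  move=> /subnK <-; elim: (j - i)%N => [|k IHk]; first exact: lifts_refl (sP i).1.
  by apply: lifts_trans IHk _; case: (s_step (k + i)%N).
pose S := [set t | exists k, (s k).1 = t].
have supS : has_sup S.
  by split; [exists (s 0%N).1, 0%N|exists 1 => _ [k <-]; case: (sP k)].
pose l := sup S.
have le_l k : (s k).1 <= l by apply: sup_upper_bound => //; exists k.
have near_l (e : R) : 0 < e -> exists n, forall i, (n <= i)%N -> l - e < (s i).1.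
  move=> e0; have [_ [n <-] hn] := sup_adherent e0 supS.
  by exists n => i ni; apply: lt_le_trans hn _; case: (s_lifts _ _ ni).
have L0 : 0 <= L by apply: le_trans (dgam_bounded 0); rewrite sqrtr_ge0.
have K0 : 0 < L * pi + 1 by rewrite ltr_wpDl // mulr_ge0 // pi_ge0.
have dist_s i j (e : R) : 0 < e -> l - e / (L * pi + 1) < (s i).1 ->
    l - e / (L * pi + 1) < (s j).1 -> (surf_dist f (s i).2 (s j).2 < e%:E)%E.
  move=> e0 li lj.
  have [lift_ij] : (surf_dist f (s i).2 (s j).2
      <= (L * pi * `|(s j).1 - (s i).1|)%:E)%E.
    have [ij|/ltnW ji] := leqP i j; first exact: (lifts_dist (s_lifts _ _ ij)).1.
    by rewrite distrC; exact: (lifts_dist (s_lifts _ _ ji)).2.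
  apply: le_lt_trans lift_ij _; rewrite lte_fin.
  set d := e / (L * pi + 1) in li lj.
  have dE : (L * pi + 1) * d = e by rewrite /d mulrC divfK // gt_eqF.
  have lik := le_l i; have ljk := le_l j.
  have d0 : 0 < d by rewrite divr_gt0.
  have dij : `|(s j).1 - (s i).1| <= d by rewrite ler_norml; lra.
  have Lpi0 : 0 <= L * pi by rewrite mulr_ge0 // pi_ge0.
  have := ler_wpM2l Lpi0 dij; move: dE; rewrite mulrDl mul1r; lra.
have cauchy_s (e : R) : 0 < e -> exists n0 : nat, forall i j : nat,
    (n0 <= i)%N -> (n0 <= j)%N -> (surf_dist f (s i).2 (s j).2 < e%:E)%E.
  move=> e0; have [n hn] := near_l _ (divr_gt0 e0 K0).
  by exists n => i j ni nj; apply: dist_s => //; exact: hn.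
have [p s_to_p] := completef cauchy_s.
have fp : f p = gam l.
  apply/eqP; rewrite -subr_eq0 -normr_le0; apply/ler_addgt0Pl => e e0; rewrite addr0.
  have e20 : 0 < e / 2 by rewrite divr_gt0.
  have /cvgrPdist_lt/(_ _ e20) gam_near := @gam_continuous l.
  have [d /= d0 hd] := (nbhs_ballP _ _).1 gam_near.
  have [n1 hn1] := near_l _ d0; have [n2 hn2] := s_to_p _ e20.
  pose k := maxn n1 n2.
  have h1 : `|gam l - gam (s k).1| < e / 2.
    apply: hd; rewrite -ball_normE /= ger0_norm ?subr_ge0 //.
    by have := hn1 k (leq_maxl _ _); lra.
  have h2 : `|f (s k).2 - f p| < e / 2.
    by rewrite -lte_fin; apply: le_lt_trans (surf_dist_ge _ _ _) (hn2 k (leq_maxr _ _)).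
  apply: le_trans (ler_distD (gam (s k).1) _ _) _.
  by rewrite [leRHS]splitr lerD ?ltW // -?(sP k).1 distrC // (sP k).1.
have [l1|l1] := leP 1 l.
  exists p; rewrite fp; congr gam; apply: le_anti; rewrite l1 andbT.
  by apply: sup_le_ub; [case: supS|move=> _ [k <-]; case: (sP k)].
have [r [nbO [g [r_gt0 nO cg liftg uniqg]]]] :=
  local_lift eps0 surff orthogonal_eq gam_continuous gamT fp.
pose t' := Num.min (l + r) 1.
have lt' : l < t' by rewrite lt_min l1 andbT ltrDl.
have t'_le : t' <= l + r by rewrite ge_min lexx.
have [e e0 smallO] := small_dist_nbhd surff nO.
have [n1 hn1] := s_to_p _ e0.
have gap0 : 0 < t' - l by rewrite subr_gt0.
have [n2 hn2] := near_l _ gap0.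
pose k := maxn n1 n2.
have Ok : nbO (s k).2 by apply: smallO; apply: hn1; exact: leq_maxl.
have hk := hn2 k (leq_maxr _ _); have lk := le_l k.
have sk_near : `|(s k).1 - l| <= r by rewrite ler_norml; lra.
have gk : g (s k).1 = (s k).2 by apply: uniqg => //; case: (sP k).
have lift_k : lifts (s k) (t', g t').
  split => /=; first lra.
  exists g; split => // t /andP[kt tt']; apply: liftg.
  by rewrite ler_norml; lra.
have [_ _ greedy] := s_step k.
have := greedy _ lift_k; rewrite /= ge_min lexx orbT => /(_ isT).
have := le_l k.+1; rewrite /s /= -/(s k); lra.
Qed.
End PathLifting.

(** * Right multiplications and rotations of circles *)


(** Right multiplication by the conjugate of q, in coordinates. *)
Definition frame_coords (R : realType) (q p : 'rV[R]_4) : 'rV[R]_4 :=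
  quat (dot p q) (dot p (vfV q)) (dot p (vfE1 q)) (dot p (vfE2 q)).

Definition frame_point (R : realType) (q : 'rV[R]_4) (x0 x1 x2 x3 : R) : 'rV[R]_4 :=
  x0 *: q + x1 *: vfV q + x2 *: vfE1 q + x3 *: vfE2 q.

Lemma frame_coords_linear (R : realType) (q : 'rV[R]_4) : linear (frame_coords q).
Proof.
by move=> a u v; apply: row4P; rewrite !coordE !dotE.
Qed.

HB.instance Definition _ (R : realType) (q : 'rV[R]_4) :=
  GRing.isLinear.Build R 'rV[R]_4 'rV[R]_4 *:%R (frame_coords q) (frame_coords_linear q).

Lemma dot_frame_coords (R : realType) (q u v : 'rV[R]_4) :
  dot (frame_coords q u) (frame_coords q v) = dot q q * dot u v.
Proof. by rewrite [LHS]dotE4 !quatE quaternion_parseval. Qed.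

Lemma frame_coords_point (R : realType) (q : 'rV[R]_4) (x0 x1 x2 x3 : R) :
  frame_coords q (frame_point q x0 x1 x2 x3) = dot q q *: quat x0 x1 x2 x3.
Proof.
apply: row4P; rewrite !coordE /frame_point !dotE !dotE4 !vfVE !vfE1E !vfE2E !quatE; ring.
Qed.

Lemma frame_coords_inj (R : realType) (q u v : 'rV[R]_4) : dot q q != 0 ->
  frame_coords q u = frame_coords q v -> u = v.
Proof.
move=> q0 uv; apply/subr0_eq/dot_eq0/(mulfI q0).
by rewrite mulr0 -dot_frame_coords linearB /= uv subrr dot0l.
Qed.

Lemma frame_coords_vfE1 (R : realType) (q p : 'rV[R]_4) :
  frame_coords q (vfE1 p) = vfE1 (frame_coords q p).
Proof.
by apply: row4P; rewrite /frame_coords !(vfVE, vfE1E, vfE2E, dotE4, quatE); ring.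
Qed.

Lemma frame_coords_vfE2 (R : realType) (q p : 'rV[R]_4) :
  frame_coords q (vfE2 p) = vfE2 (frame_coords q p).
Proof.
by apply: row4P; rewrite /frame_coords !(vfVE, vfE1E, vfE2E, dotE4, quatE); ring.
Qed.

Lemma cst_Ck (R : realType) n m k (U : set 'rV[R]_n.+1) (c : 'rV[R]_m.+1) :
  Ck k U (fun _ => c).
Proof.
elim: k c => [|k IHk] c /=; first by move=> u _; exact: cst_continuous.
split=> [u _|v]; first exact: differentiable_cst.
have -> : (fun u => 'D_v (fun _ => c) u) = (fun _ : 'rV[R]_n.+1 => 0 : 'rV[R]_m.+1).
  by apply/funext => u; exact: derive_cst.
exact: IHk.
Qed.

Lemma linear_Ck (R : realType) n m k (U : set 'rV[R]_n.+1)
    (F : {linear 'rV[R]_n.+1 -> 'rV[R]_m.+1}) : Ck k U F.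
Proof.
case: k => [|k] /=; first by move=> u _; exact: linear_rV_continuous.
split=> [u _|v]; first by case: (linear_rV_diff F u).
have -> : (fun u => 'D_v F u) = (fun _ : 'rV[R]_n.+1 => F v).
  by apply/funext => u; have [dF dFE] := linear_rV_diff F u; rewrite deriveE ?dFE.
exact: cst_Ck.
Qed.

(** Right multiplications commute with the left multiplications that define
    the three vector fields. *)
Lemma frame_coords_isometry (R : realType) (q : 'rV[R]_4) : dot q q = 1 ->
  horizontal_isometry (frame_coords q).
Proof.
move=> qq.
have dPhi p : 'd (frame_coords q) p = frame_coords q :> ('rV[R]_4 -> 'rV[R]_4).
  by have [_ ->] := linear_rV_diff (frame_coords q) p.
split.
- exists setT; split => //; first exact: openT.
  by move=> k; exact: linear_Ck.
- split.
  + move=> p /enorm_unit pp; apply/enorm_unit.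
    by rewrite dot_frame_coords qq mul1r.
  + move=> u v _ _; apply: frame_coords_inj; by rewrite qq oner_eq0.
  + move=> x /enorm_unit xx.
    have xE : frame_coords q (frame_point q (x 0 0) (x 0 1) (x 0 2) (x 0 3)) = x.
      by rewrite frame_coords_point qq scale1r; apply: row4P; rewrite quatE.
    exists (frame_point q (x 0 0) (x 0 1) (x 0 2) (x 0 3)) => //.
    apply/enorm_unit; have := dot_frame_coords q
      (frame_point q (x 0 0) (x 0 1) (x 0 2) (x 0 3))
      (frame_point q (x 0 0) (x 0 1) (x 0 2) (x 0 3)).
    by rewrite xE qq mul1r xx => <-.
- by move=> p u v _ _ _; rewrite !dPhi dot_frame_coords qq mul1r.
- move=> p _; rewrite dPhi; apply/seteqP; split => [_ [_ [a [b ->]] <-]|_ [a [b ->]]].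
    exists a, b; rewrite linearD !linearZ /=.
    by rewrite frame_coords_vfE1 frame_coords_vfE2.
  exists (a *: vfE1 p + b *: vfE2 p); first by exists a, b.
  by rewrite linearD !linearZ /= frame_coords_vfE1 frame_coords_vfE2.
Qed.

Lemma polar_angle (R : realType) (x y : R) : x ^+ 2 + y ^+ 2 = 1 ->
  exists a, cos a = x /\ sin a = y.
Proof.
move=> xy.
have x11 : -1 <= x <= 1.
  rewrite -ler_norml -(ler_sqr (normr_ge0 _)) ?nnegrE // real_normK ?num_real //.
  by rewrite expr1n -xy lerDl sqr_ge0.
have cosx : cos (acos x) = x by rewrite acosK // in_itv.
have sinx : sin (acos x) = `|y|.
  by rewrite sin_acos // -xy addrAC subrr add0r sqrtr_sqr.
have [y0|y0] := leP 0 y.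
  by exists (acos x); rewrite cosx sinx ger0_norm.
by exists (- acos x); rewrite cosN sinN cosx sinx ltr0_norm // opprK.
Qed.

Lemma rotation_angle (R : realType) (a b c d r : R) : 0 < r ->
  a ^+ 2 + b ^+ 2 = r -> c ^+ 2 + d ^+ 2 = r ->
  exists t, a = cos t * c - sin t * d /\ b = sin t * c + cos t * d.
Proof.
move=> r0 ab cd; have rn0 : r != 0 by rewrite gt_eqF.
have [|t [ct st]] := @polar_angle R ((a * c + b * d) / r) ((b * c - a * d) / r).
  rewrite !exprMn -mulrDl -[RHS](mulfV (mulf_neq0 rn0 rn0)) exprVn expr2.
  by congr (_ / _); rewrite -{1}ab -cd; ring.
exists t; rewrite ct st; split.
  have -> : (a * c + b * d) / r * c - (b * c - a * d) / r * d
    = a * (c ^+ 2 + d ^+ 2) / r by field.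
  by rewrite cd mulfK.
have -> : (b * c - a * d) / r * c + (a * c + b * d) / r * d
  = b * (c ^+ 2 + d ^+ 2) / r by field.
by rewrite cd mulfK.
Qed.

(** The cross product vanishes, so the scalar product is r or -r; in the second
    case the points are antipodal, at distance 2 sqrt r. *)
Lemma circle_eq (R : realType) (a b c d r : R) :
  a ^+ 2 + b ^+ 2 = r -> c ^+ 2 + d ^+ 2 = r -> c * b = d * a ->
  (a - c) ^+ 2 + (b - d) ^+ 2 < 4 * r -> a = c /\ b = d.
Proof.
move=> ab cd cross near_.
pose x := a * c + b * d.
have /eqP : x ^+ 2 = r ^+ 2.
  transitivity (r * r - (c * b - d * a) ^+ 2); last by rewrite cross; ring.
  by rewrite -{1}ab -cd /x; ring.
have distE : (a - c) ^+ 2 + (b - d) ^+ 2 = 2 * r - 2 * x.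
  by transitivity (a ^+ 2 + b ^+ 2 + (c ^+ 2 + d ^+ 2) - 2 * x);
    [rewrite /x; ring|rewrite ab cd; ring].
rewrite eqf_sqr => /orP[/eqP xr|/eqP xr]; last by move: near_; rewrite distE xr; lra.
have /eqP : (a - c) ^+ 2 + (b - d) ^+ 2 = 0 by rewrite distE xr subrr.
rewrite paddr_eq0 ?sqr_ge0 // !sqrf_eq0 !subr_eq0.
by move=> /andP[/eqP-> /eqP->].
Qed.

(** * Clifford tori *)


Section Torus.
Variables (R : realType) (w : 'rV[R]_4) (lam : R).
Hypothesis ww : dot w w = 1 + lam ^+ 2.
Hypothesis lam0 : lam != 0.

Let s0 : 0 < 1 + lam ^+ 2.
Proof. by rewrite ltr_wpDr ?sqr_ge0. Qed.

(** The Clifford torus whose first complex axis is spanned by w. *)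
Definition axis_torus : set 'rV[R]_4 :=
  [set y | dot y y = 1 /\ dot y w ^+ 2 + dot y (vfV w) ^+ 2 = 1].

Lemma axis_torus_other y : axis_torus y ->
  dot y (vfE1 w) ^+ 2 + dot y (vfE2 w) ^+ 2 = lam ^+ 2.
Proof.
move=> [yy y01]; have := quaternion_parseval w y y; rewrite yy ww => E.
by move: E y01; rewrite -!expr2; lra.
Qed.

(** Orthogonality to i W and i p, which span the tangent plane of the torus at p,
    puts each complex coordinate of y on the diameter of the corresponding
    coordinate of p; the bound on the distance excludes the antipodal point. *)
Lemma axis_torus_orthogonal_eq (W p y : 'rV[R]_4) : axis_torus p -> axis_torus y ->
  dot W w = (1 + lam ^+ 2) * dot p w ->
  dot W (vfV w) = (1 + lam ^+ 2) * dot p (vfV w) -> offline w W = 0 ->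
  dot y (vfV W) = 0 -> dot y (vfV p) = 0 ->
  `|y - p| < Num.min 1 `|lam| / (1 + lam ^+ 2) -> y = p.
Proof.
move=> Tp Ty W0 W1 /offline_eq0[W2 W3] yVW yVp near_yp.
have sn0 : 1 + lam ^+ 2 != 0 by rewrite gt_eqF.
have [yy y01] := Ty; have [pp p01] := Tp.
have y23 := axis_torus_other Ty; have p23 := axis_torus_other Tp.
have dist_yp : (1 + lam ^+ 2) * dot (y - p) (y - p) =
    (dot y w - dot p w) ^+ 2 + (dot y (vfV w) - dot p (vfV w)) ^+ 2 +
    ((dot y (vfE1 w) - dot p (vfE1 w)) ^+ 2 + (dot y (vfE2 w) - dot p (vfE2 w)) ^+ 2).
  by rewrite -ww quaternion_parseval !dotBl; ring.
have e1 := quaternion_parseval w (vfV W) y.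
have e2 := quaternion_parseval w (vfV p) y.
move: e1 e2; rewrite !dot_vfV_vfE1 !dot_vfV_vfE2 W2 W3 !dot_vfV !(dot_vfVl _ w).
rewrite [dot (vfV W) y]dotC [dot (vfV p) y]dotC yVW yVp W0 W1 ww => e1 e2.
have min0 : 0 <= Num.min 1 `|lam| by rewrite le_min ler01 normr_ge0.
have minl : Num.min 1 `|lam| ^+ 2 <= lam ^+ 2.
  rewrite -[leRHS]real_normK ?num_real // lerXn2r ?nnegrE //.
  by rewrite ge_min lexx orbT.
have min1 : Num.min 1 `|lam| ^+ 2 <= 1.
  by rewrite -(expr1n _ 2) lerXn2r ?nnegrE // ge_min lexx.
have d2 : dot (y - p) (y - p) * (1 + lam ^+ 2) < 4 * Num.min 1 `|lam| ^+ 2.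
  have h1 := dot_le_norm_sqr (y - p).
  set e := Num.min 1 `|lam| in near_yp *.
  have e0 : 0 < e by rewrite lt_min ltr01 normr_gt0.
  have h2 : `|y - p| ^+ 2 < (e / (1 + lam ^+ 2)) ^+ 2.
    by rewrite ltr_sqr ?nnegrE // divr_ge0 // ltW.
  have h3 : (e / (1 + lam ^+ 2)) ^+ 2 * (1 + lam ^+ 2) <= e ^+ 2.
    rewrite expr2 mulrA divfK // mulrAC -expr2 ler_pdivrMr //.
    by rewrite ler_peMr ?sqr_ge0 // lerDl sqr_ge0.
  have h4 : dot (y - p) (y - p) * (1 + lam ^+ 2)
      <= 4 * `|y - p| ^+ 2 * (1 + lam ^+ 2) by rewrite ler_wpM2r // ltW.
  have h5 : `|y - p| ^+ 2 * (1 + lam ^+ 2) < (e / (1 + lam ^+ 2)) ^+ 2 * (1 + lam ^+ 2).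
    by rewrite ltr_pM2r.
  move: h3 h4 h5; lra.
have cross1 : dot p w * dot y (vfV w) = dot p (vfV w) * dot y w.
  apply/eqP; rewrite -subr_eq0; apply/eqP/(mulfI sn0); rewrite mulr0.
  by move: e1; rewrite mulr0; lra.
have cross2 : dot p (vfE1 w) * dot y (vfE2 w) = dot p (vfE2 w) * dot y (vfE1 w).
  by move: e2 cross1; rewrite mulr0; lra.
have sq01 := addr_ge0 (sqr_ge0 (dot y w - dot p w))
  (sqr_ge0 (dot y (vfV w) - dot p (vfV w))).
have sq23 := addr_ge0 (sqr_ge0 (dot y (vfE1 w) - dot p (vfE1 w)))
  (sqr_ge0 (dot y (vfE2 w) - dot p (vfE2 w))).
rewrite mulrC dist_yp in d2.
have [|y0 y1] := circle_eq y01 p01 cross1; first by lra.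
have [|y2 y3] := circle_eq y23 p23 cross2; first by lra.
apply: (@frame_coords_inj _ w); first by rewrite ww.
by rewrite /frame_coords y0 y1 y2 y3.
Qed.

Definition torus_point (x0 x1 x2 x3 : R) : 'rV[R]_4 :=
  (1 + lam ^+ 2)^-1 *: frame_point w x0 x1 x2 x3.

Lemma torus_point_coords x0 x1 x2 x3 :
  frame_coords w (torus_point x0 x1 x2 x3) = quat x0 x1 x2 x3.
Proof.
by rewrite linearZ /= frame_coords_point ww scalerA mulVf ?gt_eqF // scale1r.
Qed.

Lemma dot_torus_point x0 x1 x2 x3 :
  dot (torus_point x0 x1 x2 x3) (torus_point x0 x1 x2 x3) =
  (1 + lam ^+ 2)^-1 * (x0 ^+ 2 + x1 ^+ 2 + (x2 ^+ 2 + x3 ^+ 2)).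
Proof.
have sn0 : 1 + lam ^+ 2 != 0 by rewrite gt_eqF.
apply: (mulfI sn0); rewrite mulVKf // -{1}ww -dot_frame_coords torus_point_coords.
by rewrite dotE4 !quatE; ring.
Qed.

Lemma torus_point_mem x0 x1 x2 x3 : x0 ^+ 2 + x1 ^+ 2 = 1 ->
  x2 ^+ 2 + x3 ^+ 2 = lam ^+ 2 -> axis_torus (torus_point x0 x1 x2 x3).
Proof.
move=> x01 x23; split; first by rewrite dot_torus_point x01 x23 mulVf // gt_eqF.
have /rowP E := torus_point_coords x0 x1 x2 x3.
by have := E 0; have := E 1; rewrite /frame_coords !quatE => -> ->.
Qed.

Lemma is_derive_torus_point (x0 x1 x2 x3 : R -> R) (y0 y1 y2 y3 t : R) :
  is_derive t (1 : R) x0 y0 -> is_derive t (1 : R) x1 y1 ->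
  is_derive t (1 : R) x2 y2 -> is_derive t (1 : R) x3 y3 ->
  is_derive t (1 : R) (fun s => torus_point (x0 s) (x1 s) (x2 s) (x3 s))
    (torus_point y0 y1 y2 y3).
Proof.
move=> d0 d1 d2 d3.
have dZ (x : R -> R) (y : R) (v : 'rV[R]_4) : is_derive t (1 : R) x y ->
    is_derive t (1 : R) (fun s => x s *: v) (y *: v).
  move=> dx; apply: (is_derive_curve_comp (gam := *:%R^~ v)) dx _.
  have [dv dvE] := is_diff_scalel (x t) v.
  split; first exact: diff_derivable.
  by rewrite deriveE // dvE scale1r.
have D0 := dZ _ _ w d0; have D1 := dZ _ _ (vfV w) d1.
have D2 := dZ _ _ (vfE1 w) d2; have D3 := dZ _ _ (vfE2 w) d3.
exact: is_deriveZ _ (is_deriveD (is_deriveD (is_deriveD D0 D1) D2) D3).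
Qed.

Lemma continuous_torus_point (x0 x1 x2 x3 : R -> R) :
  continuous x0 -> continuous x1 -> continuous x2 -> continuous x3 ->
  continuous (fun s => torus_point (x0 s) (x1 s) (x2 s) (x3 s)).
Proof.
move=> c0 c1 c2 c3 t; apply: cvgZ; first exact: cvg_cst.
have cZ (x : R -> R) (v : 'rV[R]_4) : continuous x ->
    x s *: v @[s --> t] --> x t *: v.
  by move=> cx; apply: cvgZ; [exact: cx|exact: cvg_cst].
exact: cvgD (cvgD (cvgD (cZ _ w c0) (cZ _ (vfV w) c1)) (cZ _ (vfE1 w) c2))
  (cZ _ (vfE2 w) c3).
Qed.

(** The real part of exp (i a t) (c + i d); the imaginary part is
    [rotated a d (- c)]. *)
Definition rotated (a c d t : R) : R := cos (a * t) * c - sin (a * t) * d.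

Lemma is_derive_rotated a c d (t : R) :
  is_derive t (1 : R) (rotated a c d) (a * rotated a (- d) c t).
Proof.
have da : is_derive t (1 : R) ( *%R a) a.
  have -> : *%R a = a *: (id : R -> R) by [].
  by apply: is_derive_eq; rewrite /GRing.scale /= mulr1.
have dcos := is_derive1_comp (f := cos) (is_derive_cos (a * t)) da.
have dsin := is_derive1_comp (f := sin) (is_derive_sin (a * t)) da.
have -> : rotated a c d = c *: (cos \o ( *%R a)) - d *: (sin \o ( *%R a)).
  by apply/funext => s; rewrite /rotated mulrC [X in _ - X]mulrC.
apply: is_derive_eq; rewrite /rotated /GRing.scale /=; ring.
Qed.

Lemma rotated_continuous a c d : continuous (rotated a c d).
Proof.
move=> t; apply/differentiable_continuous/derivable1_diffP.
by case: (is_derive_rotated a c d t).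
Qed.

Lemma rotated_sqr a c d t :
  rotated a c d t ^+ 2 + rotated a d (- c) t ^+ 2 = c ^+ 2 + d ^+ 2.
Proof.
transitivity ((cos (a * t) ^+ 2 + sin (a * t) ^+ 2) * (c ^+ 2 + d ^+ 2)).
  by rewrite /rotated; ring.
by rewrite cos2Dsin2 mul1r.
Qed.

(** The two complex coordinates rotate with constant speed from those of p to
    those of y, so the speed of the curve is constant. *)
Lemma axis_torus_curve p y : axis_torus p -> axis_torus y ->
  exists (gam dgam : R -> 'rV[R]_4) (L : R),
  [/\ gam 0 = p, gam 1 = y & forall t, axis_torus (gam t)] /\
  [/\ forall t : R, is_derive t (1 : R) gam (dgam t), continuous dgam &
    forall t, enorm (dgam t) <= L].
Proof.
move=> Tp Ty.
have [pp p01] := Tp; have [yy y01] := Ty.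
have p23 := axis_torus_other Tp; have y23 := axis_torus_other Ty.
have lam20 : 0 < lam ^+ 2 by rewrite exprn_even_gt0.
have [a [ya0 ya1]] := rotation_angle ltr01 y01 p01.
have [b [yb2 yb3]] := rotation_angle lam20 y23 p23.
set c0 := dot p w in ya0 ya1 p01 *; set c1 := dot p (vfV w) in ya0 ya1 p01 *.
set c2 := dot p (vfE1 w) in yb2 yb3 p23 *.
set c3 := dot p (vfE2 w) in yb2 yb3 p23 *.
pose gam t := torus_point (rotated a c0 c1 t) (rotated a c1 (- c0) t)
  (rotated b c2 c3 t) (rotated b c3 (- c2) t).
pose dgam t := torus_point (a * rotated a (- c1) c0 t) (a * rotated a c0 c1 t)
  (b * rotated b (- c3) c2 t) (b * rotated b c2 c3 t).
have w0 : dot w w != 0 by rewrite ww gt_eqF.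
exists gam, dgam, (Num.sqrt ((1 + lam ^+ 2)^-1 * (a ^+ 2 + b ^+ 2 * lam ^+ 2))).
split; split.
- apply: (frame_coords_inj w0); rewrite torus_point_coords /rotated !mulr0 cos0 sin0.
  by rewrite /frame_coords -/c0 -/c1 -/c2 -/c3; congr quat; ring.
- apply: (frame_coords_inj w0); rewrite torus_point_coords /rotated !mulr1.
  by rewrite /frame_coords ya0 ya1 yb2 yb3; congr quat; ring.
- by move=> t; apply: torus_point_mem; rewrite rotated_sqr.
- move=> t; apply: is_derive_torus_point; try exact: is_derive_rotated.
    by have := is_derive_rotated a c1 (- c0) t; rewrite opprK.
  by have := is_derive_rotated b c3 (- c2) t; rewrite opprK.
- apply: continuous_torus_point => t; apply: cvgM; try exact: cvg_cst;
    exact: rotated_continuous.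
- move=> t; have inv0 : 0 <= (1 + lam ^+ 2)^-1 by rewrite invr_ge0 ltW.
  rewrite /enorm ler_wsqrtr // dot_torus_point ler_wpM2l //.
  have e1 : rotated a (- c1) c0 t ^+ 2 = rotated a c1 (- c0) t ^+ 2.
    by rewrite /rotated; ring.
  have e2 : rotated b (- c3) c2 t ^+ 2 = rotated b c3 (- c2) t ^+ 2.
    by rewrite /rotated; ring.
  rewrite !exprMn e1 e2 -!mulrDr (addrC (rotated a c1 _ _ ^+ 2)).
  by rewrite (addrC (rotated b c3 _ _ ^+ 2)) !rotated_sqr p01 p23 mulr1.
Qed.
End Torus.

(** The isometry is the right multiplication that sends the axis w to the first
    complex coordinate axis. *)
Lemma axis_torus_congruent (R : realType) (w : 'rV[R]_4) (rho : R) :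
  0 < rho -> dot w w = rho ^- 2 ->
  congruent (axis_torus w) (clifford_torus rho).
Proof.
move=> r0 ww; pose q := rho *: w.
have rn0 : rho != 0 by rewrite gt_eqF.
have qq : dot q q = 1.
  by rewrite /q !dotE ww mulrA -expr2 mulfV // expf_neq0.
have isoq := frame_coords_isometry qq.
have coords p : frame_coords q p 0 0 ^+ 2 + frame_coords q p 0 1 ^+ 2 =
    rho ^+ 2 * (dot p w ^+ 2 + dot p (vfV w) ^+ 2).
  by rewrite !quatE /q linearZ /= !dotE; ring.
exists (frame_coords q); split => //; apply/seteqP; split => [_ [p [pp p01] <-]|y].
  split; last by rewrite coords p01 mulr1.
  by apply/enorm_unit; rewrite dot_frame_coords qq mul1r.
move=> [yS3 y01]; have [_ _ surj] := iso_bij isoq.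
have [p pS3 py] := surj y yS3; exists p => //.
split; first exact/enorm_unit.
have := coords p; rewrite py y01 => /esym/eqP.
rewrite -[X in _ == X]mulr1 => /eqP /mulfI -> //.
by rewrite expf_neq0.
Qed.

Theorem proposition5p11 (R : realType) (M : topologicalType)
    (f N : M -> 'rV[R]_4)
    (hsurface : C2_surface f)
    (hcomplete : complete_surface f)
    (hconnected : connected [set: M])
    (horiented : unit_normal f N)
    (hcmc : constant_mean_curvature f N)
    (hvertical : vertical f) :
  exists rho : R, [/\ 0 < rho, rho < 1 & congruent (range f) (clifford_torus rho)].
Proof.
have [m0 _] := surf_nonempty hsurface.
have [H divH] := hcmc.
pose h := - (2 * H).
have divN m : is_divergence f N m h.
  rewrite -(nuh_vertical horiented hvertical); apply: divH.
  exact: nonsingular_vertical.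
(* The positive root of lam ^+ 2 = 1 + h * lam. *)
pose lam := (h + Num.sqrt (h ^+ 2 + 4)) / 2.
have lamE : lam ^+ 2 = 1 + h * lam.
  have sqE : Num.sqrt (h ^+ 2 + 4) ^+ 2 = h ^+ 2 + 4.
    by rewrite sqr_sqrtr // addr_ge0 ?sqr_ge0.
  transitivity ((h ^+ 2 + 2 * h * Num.sqrt (h ^+ 2 + 4) + Num.sqrt (h ^+ 2 + 4) ^+ 2) / 4).
    by rewrite /lam; field.
  by rewrite sqE /lam; field.
have lam0 : lam != 0.
  apply/eqP => lam0; move: lamE; rewrite lam0 expr0n mulr0 addr0 => /eqP.
  by rewrite eq_sym oner_eq0.
pose W := axis_vector f N lam.
pose w := W m0.
have ww : dot w w = 1 + lam ^+ 2 by exact: axis_vector_dot.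
have coordsW m := axis_vector_coordinates hsurface horiented hvertical divN lamE
  hconnected m0 m.
have fT m : axis_torus w (f m).
  by have [_ _ f01] := coordsW m; split => //; exact: (surface_dot (surf_S3 hsurface)).
have eps0 : 0 < Num.min 1 `|lam| / (1 + lam ^+ 2).
  by rewrite divr_gt0 // ?lt_min ?ltr01 ?normr_gt0 // ltr_wpDr ?sqr_ge0.
have rangeT : range f = axis_torus w.
  apply/seteqP; split => [_ [m _ <-]|y Ty]; first exact: fT.
  have [gam [dgam [L [[gam0 gam1 gamT] [dgamE cdgam dgamL]]]]] :=
    axis_torus_curve ww lam0 (fT m0) Ty.
  suff [m fm] : exists m, f m = gam 1 by exists m => //; rewrite fm.
  apply: (path_lifting eps0 hsurface hcomplete _ dgamE cdgam dgamL gamT (esym gam0)).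
  move=> U X u z cX Uu Tz near_z orth.
  have [Ww WVw _] := coordsW (X u).
  have orthV a b : dot z (a *: vfV (f (X u)) + b *: vfV (N (X u))) = 0.
    have [v dv] := chart_tangent_plane (surf_S3 hsurface) horiented hvertical cX a b Uu.
    have := orth v; rewrite dv dotBl => /eqP; rewrite subr_eq0 => /eqP ->.
    rewrite !dotE dot_vfV_self [dot (f _) _]dotC dot_vfVl.
    by rewrite (normal_dot_vertical horiented hvertical) oppr0 !mulr0 addr0.
  apply: (axis_torus_orthogonal_eq ww lam0 (fT (X u)) Tz Ww WVw) => //.
  - exact: (offline_constant hsurface horiented hvertical divN lamE hconnected).
  - have := orthV 1 lam; rewrite scale1r => <-; congr (dot z _).
    by rewrite (linearD (@vfV R)) linearZ.
  - by have := orthV 1 0; rewrite scale1r scale0r addr0.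
have s0 : 0 < 1 + lam ^+ 2 by rewrite ltr_wpDr ?sqr_ge0.
pose rho := (Num.sqrt (1 + lam ^+ 2))^-1.
have sqrt0 : 0 < Num.sqrt (1 + lam ^+ 2) by rewrite sqrtr_gt0.
exists rho; split.
- by rewrite invr_gt0.
- rewrite invf_lt1 // -[ltLHS]sqrtr1 ltr_sqrt //.
  by rewrite ltrDl exprn_even_gt0.
- rewrite rangeT; apply: axis_torus_congruent; first by rewrite invr_gt0.
  by rewrite /rho exprVn invrK sqr_sqrtr // ltW.
Qed.
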